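(* There exists an unstable vortex $\bar\Omega\in C_c^\infty(\mathbb{R}^2)$ with zero mean, i.e. $\int_{\mathbb{R}^2}\bar\Omega(x)\,dx=0$.
   Context: A vortex is a radially symmetric function $\bar\omega(x)=\bar w(r)$, in polar coordinates $x=re^{i\theta}$ on $\mathbb{R}^2\cong\mathbb{C}$; its velocity is $\bar v=\bar v_\theta(r)e_\theta$ with $e_\theta=ie^{i\theta}$ and $r\bar w=\partial_r(r\bar v_\theta)$, i.e. $\bar v=\nabla^\perp\Delta^{-1}\bar\omega$ (Biot-Savart law). The linearization of the 2D Euler equation $\partial_t\omega+v\cdot\nabla\omega=0$, $v=\nabla^\perp\Delta^{-1}\omega$, around $\bar\omega$ is $L=T+K$ with $T\omega=-\bar v\cdot\nabla\omega$ and $K\omega=-v\cdot\nabla\bar\omega$, $v=\nabla^\perp\Delta^{-1}\omega$. For $n\in\mathbb{N}=\{1,2,\dots\}$ let $U_n=\{w\in L^2(\mathbb{R}^2;\mathbb{C}): w(x)=w_n(r)e^{in\theta}\}$. On $U_n$ these operators read $$Tw=-in\,e^{in\theta}\frac{\bar v_\theta(r)}{r}w_n(r),\qquad Kw=-ie^{in\theta}\partial_r\bar w(r)\int_0^\infty K_n\Big(\frac rs\Big)w_n(s)\,ds,$$ with $K_n(\rho)=\tfrac12\rho^{n-1}$ for $\rho\le1$ and $K_n(\rho)=\tfrac12\rho^{-n-1}$ for $\rho>1$ (the integral being required to converge absolutely). The vortex $\bar\omega$ is called unstable if for some $n\in\mathbb{N}$ there exist $0\ne w\in U_n$ and $\lambda\in\mathbb{C}$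 with $\Re\lambda>0$ such that $Lw=\lambda w$. *)

(* Defs.v *)
From HB Require Import structures.
From mathcomp Require Import all_boot all_order all_algebra.
From mathcomp Require Import all_classical all_reals all_analysis.
From mathcomp Require Import complex.

Set Implicit Arguments.
Unset Strict Implicit.
Unset Printing Implicit Defensive.

Import Order.TTheory GRing.Theory Num.Theory.
Import numFieldNormedType.Exports.

Local Open Scope classical_set_scope.
Local Open Scope ring_scope.

(* The plane is [R * R] with Lebesgue measure; MathComp-Analysis puts the sup
   norm on the product, so the Euclidean modulus is written out. *)
Definition lebesgue2 (R : realType) :=
  (@lebesgue_measure R \x @lebesgue_measure R)%E.

Definition radius (R : realType) (x : R * R) : R :=
  Num.sqrt (x.1 ^+ 2 + x.2 ^+ 2).

(* [e^{i n theta}], computed as [(x / |x|)^n]; its value at the origin is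
   irrelevant, everything below being used almost everywhere. *)
Definition angular_mode (R : realType) (n : nat) (x : R * R) : R[i] :=
  ((x.1 / radius x) +i* (x.2 / radius x))%C ^+ n.

Fixpoint Ck (R : realType) (k : nat) (f : R * R -> R) : Prop :=
  if k is k'.+1 then
    [/\ continuous f,
        forall x, derivable f x (1, 0) /\ derivable f x (0, 1),
        Ck k' ('D_(1, 0) f) & Ck k' ('D_(0, 1) f)]
  else continuous f.

Definition Cc_infty (R : realType) (f : R * R -> R) : Prop :=
  (forall k, Ck k f) /\ compact (closure [set x | f x != 0]).

Definition radial_profile (R : realType) (Omega : R * R -> R) (wbar : R -> R) :
    Prop :=
  forall x, Omega x = wbar (radius x).

(* [r wbar = d/dr (r vbar)] determines [r vbar] up to a constant; the
   Biot-Savart law selects the solution without a point vortex at the origin. *)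
Definition angular_velocity (R : realType) (wbar vbar : R -> R) : Prop :=
  (forall r : R, 0 < r ->
     is_derive r (1 : R) (fun s : R => s * vbar s) (r * wbar r)) /\
  (fun s : R => s * vbar s) @ 0^'+ --> (0 : R).

(* Radial kernel of the Biot-Savart law on [e^{i n theta}] modes: the radial
   velocity of [w_n(r) e^{i n theta}] is
   [i e^{i n theta} \int_0^oo kernel_K n (r / s) w_n(s) ds]. *)
Definition kernel_K (R : realType) (n : nat) (rho : R) : R :=
  if rho <= 1 then 2^-1 * rho ^+ n.-1 else 2^-1 * rho ^- n.+1.

(* Equivalent to absolute convergence: [s |-> |f s|] is Lebesgue integrable iff
   the real and imaginary parts are, for measurable [f]. *)
Definition complex_integrable (R : realType) (D : set R) (f : R -> R[i]) :
    Prop :=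
  (@lebesgue_measure R).-integrable D (fun s => (complex.Re (f s))%:E) /\
  (@lebesgue_measure R).-integrable D (fun s => (complex.Im (f s))%:E).

Definition complex_integral (R : realType) (D : set R) (f : R -> R[i]) : R[i] :=
  ((\int[@lebesgue_measure R]_(s in D) complex.Re (f s)) +i*
   (\int[@lebesgue_measure R]_(s in D) complex.Im (f s)))%C.

Definition kernel_integrand (R : realType) (n : nat) (wn : R -> R[i])
    (r s : R) : R[i] :=
  (kernel_K n (r / s))%:C%C * wn s.

(* [T w = - v . grad w] and [K w = - u . grad omega], for the vortex [omega]
   with velocity [v], on [w = wn(r) e^{i n theta}], where
   [u = grad^perp Delta^{-1} w]. *)
Definition T_mode (R : realType) (n : nat) (vbar : R -> R) (wn : R -> R[i])
    (x : R * R) : R[i] :=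
  - ('i%C * n%:R * angular_mode n x
     * (vbar (radius x) / radius x)%:C%C * wn (radius x)).

Definition K_mode (R : realType) (n : nat) (wbar : R -> R) (wn : R -> R[i])
    (x : R * R) : R[i] :=
  - ('i%C * angular_mode n x * (derive1 wbar (radius x))%:C%C
     * complex_integral `]0, +oo[ (kernel_integrand n wn (radius x))).

Definition L_mode (R : realType) (n : nat) (wbar vbar : R -> R)
    (wn : R -> R[i]) (x : R * R) : R[i] :=
  T_mode n vbar wn x + K_mode n wbar wn x.

(* Elements of [L^2] are represented by Borel functions and compared almost
   everywhere. *)
Definition L2 (R : realType) (w : R * R -> R[i]) : Prop :=
  (fun x => complex.Re (w x)) \in Lfun (@lebesgue2 R) 2%:E /\
  (fun x => complex.Im (w x)) \in Lfun (@lebesgue2 R) 2%:E.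

Definition in_U (R : realType) (n : nat) (w : R * R -> R[i])
    (wn : R -> R[i]) : Prop :=
  L2 w /\
  {ae @lebesgue2 R, forall x, w x = wn (radius x) * angular_mode n x}.

Definition unstable_vortex (R : realType) (Omega : R * R -> R) : Prop :=
  exists wbar vbar : R -> R,
    [/\ radial_profile Omega wbar,
        angular_velocity wbar vbar &
        exists n : nat, (0 < n)%N /\
        exists (w : R * R -> R[i]) (wn : R -> R[i]) (lambda : R[i]),
          [/\ in_U n w wn,
              ~ {ae @lebesgue2 R, forall x, w x = 0},
              (forall r : R, 0 < r ->
                 complex_integrable `]0, +oo[ (kernel_integrand n wn r)),
              0 < complex.Re lambda &
              {ae @lebesgue2 R,
                 forall x, L_mode n wbar vbar wn x = lambda * w x}]].

(* Main.v *)
(* The unstable mode is the Kelvin-Helmholtz instability of a smoothed vortex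
   sheet. Take angular velocity [x(r) - b], where [x] goes from [a] to [b] across
   the thin annulus [1 <= r <= 1 + h]: vorticity and velocity both vanish beyond
   it, so the mean is zero. With [n = 2] and the phase speed normalized so that it
   enters as [x - i], the substitution [phi = r (x - i) eta] in the Rayleigh
   equation gives, for [xi = r (x - i)^2 eta'],
     [r eta' = xi / (x - i)^2],  [r xi' = 3 (x - i)^2 eta - 2 xi],
   which involves no derivative of [x]. Hence [eta] and [xi] are nearly constant
   across a thin annulus, and matching the regular solutions on both sides reduces,
   up to [O(h)], to [(a - i)^2 + 3 (b - i)^2 = 0]. This is solved, nondegenerately,
   by [(a, b) = (sqrt 3, - 1 / sqrt 3)], so a contraction yields exact real [a] and
   [b]. The mode is [w = - wbar' eta / 2], with eigenvalue [- 2 i (i - b)], of real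
   part 2. *)
Require Import Defs.
From mathcomp Require Import all_boot all_order all_algebra.
From mathcomp Require Import all_classical all_reals all_analysis.
From mathcomp Require Import complex ring lra.
From mathcomp Require Import measurable_realfun.

Set Implicit Arguments.
Unset Strict Implicit.
Unset Printing Implicit Defensive.

Import Order.TTheory GRing.Theory Num.Theory.
Import numFieldNormedType.Exports.
Local Open Scope classical_set_scope.
Local Open Scope ring_scope.

(** * Smooth functions of one variable *)

Section Calculus.
Context {R : realType}.
Implicit Types (f g h : R -> R) (x y a b c : R).

(** The eigenvalue is prescribed and the vortex is solved for: with the phase speed fixed, the one
    complex matching condition is two real equations for the two real unknowns [a] and [b]. For mode
    [n] the regular solutions are [eta = r^(n-1)] inside and [r^(-n-1)] outside, so the limit
    condition is [(n-1) (a - i)^2 + (n+1) (b - i)^2 = 0]; at [n = 1] it has no real solution, and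
    [n = 2] is the first usable mode. The obstacle is an order of choices. The transition profile
    must fit into an annulus whose thickness [h] depends on the contraction constants, so these
    constants may not depend on the profile. They see it only through [0 <= k <= 1]. Derivatives of
    the profile return when the Biot-Savart integral is evaluated. The moments of the mode against
    [s^3] and [s^-1] have explicit antiderivatives, and their vanishing at [r = 1] and at
    [r = 1 + h] respectively is exactly the pair of matching conditions, so the integral is obtained
    in closed form. *)

Lemma deriv_eq f x a b :
  is_derive x (1 : R) f a -> a = b -> is_derive x (1 : R) f b.
Proof. by move=> ? <-. Qed.

Lemma deriv_cst c x : is_derive x (1 : R) (fun=> c) 0.
Proof. exact: is_derive_cst. Qed.

Lemma deriv_id x : is_derive x (1 : R) (fun y => y) 1.
Proof. exact: is_derive_id. Qed.

Lemma deriv_add f g x a b : is_derive x (1 : R) f a -> is_derive x (1 : R) g b ->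
  is_derive x (1 : R) (fun y => f y + g y) (a + b).
Proof. by move=> fa gb; exact: is_deriveD. Qed.

Lemma deriv_opp f x a : is_derive x (1 : R) f a ->
  is_derive x (1 : R) (fun y => - f y) (- a).
Proof. by move=> fa; exact: is_deriveN. Qed.

Lemma deriv_mul f g x a b : is_derive x (1 : R) f a -> is_derive x (1 : R) g b ->
  is_derive x (1 : R) (fun y => f y * g y) (f x * b + g x * a).
Proof. by move=> fa gb; exact: is_deriveM. Qed.

Lemma deriv_inv f x a : f x != 0 -> is_derive x (1 : R) f a ->
  is_derive x (1 : R) (fun y => (f y)^-1) (- (f x) ^- 2 * a).
Proof. by move=> fx fa; exact: is_deriveV. Qed.

Lemma deriv_comp f g x a b : is_derive (g x) (1 : R) f a ->
  is_derive x (1 : R) g b -> is_derive x (1 : R) (fun y => f (g y)) (a * b).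
Proof. by move=> fa gb; exact: is_derive1_comp. Qed.

Lemma deriv_exp f x a n : is_derive x (1 : R) f a ->
  is_derive x (1 : R) (fun y => f y ^+ n.+1) (n.+1%:R * f x ^+ n * a).
Proof.
move=> fa; have := is_deriveX n.+1 fa.
by rewrite (_ : f ^+ n.+1 = fun y => f y ^+ n.+1)//; apply/funext => y; rewrite fctE.
Qed.

Lemma deriv_continuous f x a : is_derive x (1 : R) f a -> {for x, continuous f}.
Proof. by move=> /@ex_derive /derivable1_diffP; exact: differentiable_continuous. Qed.

Lemma deriv_unique f x a b :
  is_derive x (1 : R) f a -> is_derive x (1 : R) f b -> a = b.
Proof. by move=> [_ <-] [_ <-]. Qed.

Lemma deriv_near_cst f c x a :
  (\forall y \near x, f y = c) -> is_derive x (1 : R) f a -> a = 0.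
Proof.
move=> fc fa; apply: deriv_unique fa _.
apply: near_eq_is_derive (deriv_cst c x).
by near=> y; apply/esym; near: y.
Unshelve. all: end_near. Qed.

(* The factor [s ^- k] makes the family stable under differentiation. *)
Definition flat k (s : R) : R := if 0 < s then s ^- k * expR (- s^-1) else 0.

Lemma flat_ge0 k s : 0 <= flat k s.
Proof.
rewrite /flat; case: ifP => // s0.
by rewrite mulr_ge0 ?expR_ge0// invr_ge0 exprn_ge0// ltW.
Qed.

Lemma flat_gt0 k s : 0 < s -> 0 < flat k s.
Proof. by move=> s0; rewrite /flat s0 mulr_gt0 ?expR_gt0// invr_gt0 exprn_gt0. Qed.

Lemma flat_le0 k s : s <= 0 -> flat k s = 0.
Proof. by rewrite /flat ltNge => ->. Qed.

(** From [exp t >= t^(k+2) / (k+2)!] at [t = 1/s]. A quadratic bound is what makes the difference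
    quotient at the origin tend to zero. *)
Lemma flat_bound k s : flat k s <= (k.+2)`!%:R * s ^+ 2.
Proof.
have [s0|s0] := leP s 0; first by rewrite flat_le0// mulr_ge0// sqr_ge0.
rewrite /flat s0 expRN.
have t0 : 0 < s^-1 by rewrite invr_gt0.
have := expR_ge1Dxn k.+1 (ltW t0) => le1.
have e0 : 0 < expR s^-1 := expR_gt0 _.
have le2 : s^-1 ^+ k.+2 <= k.+2`!%:R * expR s^-1.
  rewrite mulrC -ler_pdivrMr ?ltr0n ?fact_gt0//.
  by apply: le_trans le1; rewrite lerDr.
rewrite ler_pdivrMr//.
rewrite [leLHS](_ : _ = s ^+ 2 * s^-1 ^+ k.+2); last first.
  by rewrite -[k.+2]addn2 exprD exprVn exprVn mulrCA divff ?mulr1// sqrf_eq0 gt_eqF.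
by rewrite -[leRHS]mulrA [leRHS]mulrCA ler_pM2l// exprn_gt0.
Qed.

Lemma deriv_flat k s :
  is_derive s (1 : R) (flat k) (flat k.+2 s - k%:R * flat k.+1 s).
Proof.
have [s0|s0|->] := ltgtP s 0.
- rewrite !flat_le0 ?ltW// mulr0 subr0.
  apply: near_eq_is_derive (deriv_cst 0 s).
  near=> y; rewrite flat_le0// ltW//; near: y.
  exact: lt_nbhsl.
- have sE : \forall y \near s, (y^-1) ^+ k * expR (- y^-1) = flat k y.
    near=> y; rewrite /flat ifT ?exprVn//; near: y.
    exact: lt_nbhsr.
  apply: near_eq_is_derive sE _; rewrite /flat s0.
  have sn0 : s != 0 by rewrite gt_eqF.
  have dV : is_derive s (1 : R) (fun y => y^-1) (- s ^- 2 * 1).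
    by apply: deriv_inv => //; exact: deriv_id.
  have dE : is_derive s (1 : R) (fun y => expR (- y^-1))
      (expR (- s^-1) * - (- s ^- 2 * 1)).
    by apply: deriv_comp; apply: deriv_opp.
  case: k => [|k].
    apply: deriv_eq (deriv_mul (deriv_cst 1 s) dE) _.
    by rewrite !exprS !expr0; field.
  apply: deriv_eq (deriv_mul (deriv_exp k dV) dE) _.
  have : s ^+ k != 0 by rewrite expf_neq0.
  by rewrite !exprS !exprVn; move: (s ^+ k) => t t0; field; rewrite t0 sn0.
- rewrite !flat_le0// mulr0 subr0.
  have : h^-1 *: (flat k (h *: (1 : R) + 0) - flat k 0) @[h --> 0^'] --> (0 : R).
    rewrite (flat_le0 k (lexx 0)).
    apply/cvgr0Pnorm_le => e e0.
    have C0 : 0 < (k.+2)`!%:R :> R by rewrite ltr0n fact_gt0.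
    near=> h.
    have h0 : h != 0 by near: h; exact: nbhs_dnbhs_neq.
    rewrite subr0 addr0 /GRing.scale/= mulr1 normrM normfV (ger0_norm (flat_ge0 _ _)).
    rewrite ler_pdivrMl ?normr_gt0//; apply: le_trans (flat_bound _ _) _.
    rewrite -real_normK ?num_real// expr2 mulrA mulrC ler_pM2l ?normr_gt0//.
    rewrite mulrC -ler_pdivlMr//.
    near: h; apply: dnbhs0_le; exact: divr_gt0.
  move=> h0; split; first by apply/cvg_ex; exists 0.
  exact/cvg_lim.
Unshelve. all: end_near. Qed.

(** A syntactic class containing the flat functions: closure under differentiation is then a single
    induction, and it yields derivatives of all orders. *)
Inductive smooth : (R -> R) -> Prop :=
| smooth_cst c : smooth (fun=> c)
| smooth_id : smooth (fun x => x)
| smooth_flat k : smooth (flat k)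
| smooth_affine f a b : smooth f -> smooth (fun x => f (a * x + b))
| smooth_add f g : smooth f -> smooth g -> smooth (fun x => f x + g x)
| smooth_mul f g : smooth f -> smooth g -> smooth (fun x => f x * g x)
| smooth_inv f : (forall x, f x != 0) -> smooth f -> smooth (fun x => (f x)^-1).

Lemma smooth_deriv f : smooth f ->
  exists2 f', smooth f' & forall x, is_derive x (1 : R) f (f' x).
Proof.
elim=> {f} [c||k|f a b _ [f' sf' df']|f g _ [f' sf' df'] _ [g' sg' dg']
  |f g sf [f' sf' df'] sg [g' sg' dg']|f f0 sf [f' sf' df']].
- by exists (fun=> 0) => [|x]; [exact: smooth_cst|exact: deriv_cst].
- by exists (fun=> 1) => [|x]; [exact: smooth_cst|exact: deriv_id].
- exists (fun s => flat k.+2 s + (- k%:R) * flat k.+1 s).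
    by apply: smooth_add (smooth_mul _ _); [exact: smooth_flat|exact: smooth_cst|exact: smooth_flat].
  by move=> s; rewrite mulNr; exact: deriv_flat.
- exists (fun x => f' (a * x + b) * a) => [|x].
    by apply: smooth_mul (smooth_cst a); exact: smooth_affine.
  apply: deriv_comp (df' _) _.
  apply: deriv_eq (deriv_add (deriv_mul (deriv_cst a x) (deriv_id x)) (deriv_cst b x)) _.
  by ring.
- by exists (fun x => f' x + g' x) => [|x]; [exact: smooth_add|exact: deriv_add].
- exists (fun x => f x * g' x + g x * f' x) => [|x]; last exact: deriv_mul.
  by apply: smooth_add; exact: smooth_mul.
- exists (fun x => (-1) * ((f x)^-1 * (f x)^-1) * f' x) => [|x].
    apply: smooth_mul => //; apply: smooth_mul (smooth_cst _) _.
    by apply: smooth_mul; exact: smooth_inv.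
  by apply: deriv_eq (deriv_inv (f0 x) (df' x)) _; field.
Qed.

Lemma smooth_continuous f : smooth f -> continuous f.
Proof. by move=> /smooth_deriv[f' _ df] x; exact: deriv_continuous (df x). Qed.

(** Quotient of flat functions whose zero sets are disjoint, so that the denominator is positive.
    The descent takes place within [[1/4, 3/4]], which leaves neighbourhoods of 0 and 1 where the
    step is constant. *)
Lemma smooth_step_exists : exists chi : R -> R,
  [/\ smooth chi, forall s, 0 <= chi s <= 1,
      forall s, s <= 4^-1 -> chi s = 1 & forall s, 3 / 4 <= s -> chi s = 0].
Proof.
pose F s := flat 0 (2 * s + (- 2^-1)).
pose G s := flat 0 ((-2) * s + 3 / 2).
have sF : smooth F by apply: smooth_affine; exact: smooth_flat.
have sG : smooth G by apply: smooth_affine; exact: smooth_flat.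
have F0 s : 0 <= F s := flat_ge0 _ _.
have G0 s : 0 <= G s := flat_ge0 _ _.
have FG s : 0 < F s + G s.
  have [s1|s1] := leP s (1 / 2).
    by apply: ltr_wpDl => //; apply: flat_gt0; lra.
  by apply: ltr_pwDl => //; apply: flat_gt0; lra.
have FG0 s : F s + G s != 0 by rewrite gt_eqF.
exists (fun s => G s * (F s + G s)^-1); split.
- by apply: smooth_mul => //; apply: smooth_inv => //; exact: smooth_add.
- by move=> s; rewrite divr_ge0 ?(ltW (FG s))//= ler_pdivrMr// mul1r lerDr.
- move=> s s1; have F1 : F s = 0 by apply: flat_le0; lra.
  by have := FG0 s; rewrite F1 add0r => ?; rewrite divff.
- by move=> s s1; have -> : G s = 0 by [apply: flat_le0; lra]; rewrite mul0r.
Qed.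

End Calculus.

(** * Smoothness and integration in the plane *)

Section PlaneSmoothness.
Context {R : realType}.
Implicit Types (f g : R * R -> R) (h : R -> R) (p v : R * R).

(** Only the restriction to a line matters, so the one-variable rules above also serve for partial
    derivatives. *)
Lemma is_derive_line f p v d :
  is_derive 0 (1 : R) (fun t : R => f (t *: v + p)) d <-> is_derive p v f d.
Proof.
have E : (fun t : R => t^-1 *: ((fun s : R => f (s *: v + p)) (t *: (1 : R) + 0)
      - (fun s : R => f (s *: v + p)) 0)) =
    (fun t => t^-1 *: (f (t *: v + p) - f p)).
  by apply/funext => t; rewrite /= addr0 scale0r add0r /(_ *: (1 : R)) /= mulr1.
by split=> -[dr <-]; (split; last (by rewrite /derive E));
  move: dr; rewrite /derivable E.
Qed.

Definition normsq p : R := p.1 ^+ 2 + p.2 ^+ 2.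

(** Radial functions enter through [normsq] and not through the radius, which is not differentiable
    at the origin. *)
Inductive smooth2 : (R * R -> R) -> Prop :=
| smooth2_cst c : smooth2 (fun=> c)
| smooth2_fst : smooth2 fst
| smooth2_snd : smooth2 snd
| smooth2_radial h : smooth h -> smooth2 (fun p => h (normsq p))
| smooth2_add f g : smooth2 f -> smooth2 g -> smooth2 (fun p => f p + g p)
| smooth2_mul f g : smooth2 f -> smooth2 g -> smooth2 (fun p => f p * g p).

Lemma deriv_normsq_line p v :
  is_derive 0 (1 : R) (fun t : R => normsq (t *: v + p)) (2 * (p.1 * v.1 + p.2 * v.2)).
Proof.
rewrite /normsq /= /GRing.scale/=.
have dl (a b : R) : is_derive 0 (1 : R) (fun t : R => t * a + b) a.
  by apply: deriv_eq (deriv_add (deriv_mul (deriv_id _) (deriv_cst _ _)) (deriv_cst _ _)) _; ring.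
by apply: deriv_eq (deriv_add (deriv_exp 1 (dl _ _)) (deriv_exp 1 (dl _ _))) _; ring.
Qed.

Lemma continuous_normsq : continuous normsq.
Proof.
move=> p; rewrite /normsq; apply: cvgD; rewrite !expr2.
  by apply: cvgM; exact: cvg_fst.
by apply: cvgM; exact: cvg_snd.
Qed.

Lemma smooth2_continuous f : smooth2 f -> continuous f.
Proof.
elim=> {f} [c|||h sh|f g _ cf _ cg|f g _ cf _ cg] p.
- exact: cvg_cst.
- exact: cvg_fst.
- exact: cvg_snd.
- apply: continuous_comp; first exact: continuous_normsq.
  exact: smooth_continuous.
- by apply: cvgD; [exact: cf|exact: cg].
- by apply: cvgM; [exact: cf|exact: cg].
Qed.

Lemma smooth2_derive f v : smooth2 f ->
  exists2 f', smooth2 f' & forall p, is_derive p v f (f' p).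
Proof.
elim=> {f} [c|||h sh|f g _ [f' sf' df'] _ [g' sg' dg']
  |f g sf [f' sf' df'] sg [g' sg' dg']].
- by exists (fun=> 0) => [|p]; [exact: smooth2_cst|apply/is_derive_line/deriv_cst].
- exists (fun=> v.1) => [|p]; [exact: smooth2_cst|apply/is_derive_line].
  by apply: deriv_eq (deriv_add (deriv_mul (deriv_id _) (deriv_cst _ _)) (deriv_cst _ _)) _; ring.
- exists (fun=> v.2) => [|p]; [exact: smooth2_cst|apply/is_derive_line].
  by apply: deriv_eq (deriv_add (deriv_mul (deriv_id _) (deriv_cst _ _)) (deriv_cst _ _)) _; ring.
- have [h' sh' dh'] := smooth_deriv sh.
  exists (fun p => h' (normsq p) * (2 * (p.1 * v.1 + p.2 * v.2))) => [|p].
    apply: smooth2_mul; first exact: smooth2_radial.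
    apply: smooth2_mul (smooth2_cst _) (smooth2_add _ _);
      apply: smooth2_mul (smooth2_cst _); [exact: smooth2_fst|exact: smooth2_snd].
  apply/is_derive_line; apply: deriv_comp (deriv_normsq_line p v).
  by rewrite scale0r add0r; exact: dh'.
- exists (fun p => f' p + g' p) => [|p]; first exact: smooth2_add.
  by apply/is_derive_line; apply: deriv_add; apply/is_derive_line.
- exists (fun p => f p * g' p + g p * f' p) => [|p].
    by apply: smooth2_add; exact: smooth2_mul.
  have /is_derive_line lf := df' p; have /is_derive_line lg := dg' p.
  apply/is_derive_line; apply: deriv_eq (deriv_mul lf lg) _.
  by rewrite scale0r add0r.
Qed.

Lemma smooth2_Ck f k : smooth2 f -> Ck k f.
Proof.
elim: k f => [|k IH] f sf; first exact: smooth2_continuous.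
have Dv v : smooth2 ('D_v f).
  have [f' sf' df'] := smooth2_derive v sf.
  by rewrite (_ : 'D_v f = f')//; apply/funext => p; exact: derive_val.
split; [exact: smooth2_continuous| |exact: IH|exact: IH].
have d v p : derivable f p v.
  by have [f' _ df'] := smooth2_derive v sf; exact: ex_derive.
by move=> p; split.
Qed.

Definition square_box (M : R) : set (R * R) := `[- M, M]%classic `*` `[- M, M]%classic.

Lemma compact_square_box M : compact (square_box M).
Proof. by apply: compact_setX; exact: segment_compact. Qed.

Lemma not_square_box_normsq (r : R) p : 0 <= r -> ~ square_box r p -> r ^+ 2 <= normsq p.
Proof.
move=> r0 np; rewrite leNgt; apply/negP => n; apply: np.
have bnd (a : R) : a ^+ 2 <= r ^+ 2 -> a \in `[- r, r].
  by rewrite in_itv /= -ler_norml => aa; rewrite -(ger0_norm r0) -ler_sqr ?nnegrE// !real_normK ?num_real.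
move: n; rewrite /normsq => n; have := sqr_ge0 p.1; have := sqr_ge0 p.2 => y0 x0.
by split; apply: bnd; lra.
Qed.

Lemma Cc_infty_radial h (r : R) : smooth h -> (forall s, r ^+ 2 <= s -> h s = 0) ->
  0 <= r -> Cc_infty (fun p => h (normsq p)).
Proof.
move=> sh h0 r0; split=> [k|]; first by apply: smooth2_Ck; exact: smooth2_radial.
have cB := @compact_square_box r.
apply: (subclosed_compact _ cB); first exact: closed_closure.
have /closure_id -> : closed (square_box r).
  by apply: compact_closed cB; exact: norm_hausdorff.
apply: closureS => q /=; apply: contraPP => /(not_square_box_normsq r0) /h0 ->.
by rewrite eqxx.
Qed.

End PlaneSmoothness.

(** * Square integrability, and the vanishing integral of a radial divergence *)

Section PlaneIntegration.
Context {R : realType}.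
Local Notation mu := (@lebesgue_measure R).
Implicit Types (f : R * R -> R) (h : R -> R).

Lemma measurable_square_box (M : R) : measurable (square_box M).
Proof. by apply: measurableX; exact: measurable_itv. Qed.

Lemma square_box_finite (M : R) : (@lebesgue2 R (square_box M) < +oo)%E.
Proof.
have muM : mu `[- M, M]%classic \is a fin_num.
  by rewrite lebesgue_measure_itv /=; case: ifP.
rewrite /lebesgue2 /square_box product_measure1E; try exact: measurable_itv.
by apply: lte_mul_pinfty; [exact: measure_ge0|exact: muM|rewrite ltey_eq; apply/orP; left; exact: muM].
Qed.

Lemma integrable_square_box f (M C : R) : measurable_fun setT f ->
  (forall p, `|f p| <= C) -> (forall p, ~ square_box M p -> f p = 0) ->
  (@lebesgue2 R).-integrable setT (EFin \o f).
Proof.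
move=> mf fC f0.
have -> : EFin \o f = (EFin \o f) \_ (square_box M).
  apply/funext => p; rewrite patchE; case: ifPn => //= /negP pM.
  by rewrite f0// => ?; apply: pM; rewrite inE.
rewrite /lebesgue2.
apply/(integrable_mkcond (mu := (mu \x mu)%E) (EFin \o f) (measurable_square_box M)).
apply: measurable_bounded_integrable.
- exact: measurable_square_box.
- exact: square_box_finite.
- exact: measurable_funTS mf.
- exists C; split; first exact: num_real.
  by move=> x Cx p _; apply: (le_trans (fC p)); exact: ltW.
Qed.

Lemma Lfun2_square_box f (M C : R) : measurable_fun setT f ->
  (forall p, `|f p| <= C) -> (forall p, ~ square_box M p -> f p = 0) ->
  f \in Lfun (@lebesgue2 R) 2%:E.
Proof.
move=> mf fC f0; rewrite inE; apply/andP; split; first by rewrite inE/=.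
rewrite inE/= /finite_norm unlock; apply: poweR_lty.
have : (@lebesgue2 R).-integrable setT (EFin \o (fun p => f p ^+ 2)).
  apply: (@integrable_square_box _ M (C ^+ 2)).
  - exact: measurable_funX.
  - by move=> p; rewrite normrX lerXn2r// nnegrE// (le_trans (normr_ge0 _) (fC p)).
  - by move=> p /f0 ->; rewrite expr0n.
move/integrableP => [_]; apply: le_lt_trans.
rewrite le_eqVlt; apply/orP; left; apply/eqP; apply: eq_integral => p _.
by rewrite /= powR_mulrn// normrX.
Qed.

Lemma measurable_normsq : measurable_fun setT (@normsq R).
Proof.
apply: measurable_funD; apply: measurable_funX; [exact: measurable_fst|exact: measurable_snd].
Qed.

Lemma smooth2_measurable f : smooth2 f -> measurable_fun setT f.
Proof.
elim=> {f} [c|||h sh|f g _ mf _ mg|f g _ mf _ mg].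
- exact: measurable_cst.
- exact: measurable_fst.
- exact: measurable_snd.
- apply: measurableT_comp measurable_normsq.
  by apply: continuous_measurable_fun; exact: smooth_continuous.
- exact: measurable_funD.
- exact: measurable_funM.
Qed.

Lemma continuous_square_box_bounded f (M : R) : continuous f ->
  (forall p, ~ square_box M p -> f p = 0) -> exists C, forall p, `|f p| <= C.
Proof.
move=> cf f0.
have /compact_bounded : compact (f @` square_box M).
  apply: continuous_compact; last exact: compact_square_box.
  exact: continuous_subspaceT.
move=> [C [_ HC]]; exists (`|C| + 1) => p.
have [pM|pM] := pselect (square_box M p); last by rewrite f0// normr0 addr_ge0.
by apply: HC; [rewrite ltr_pwDr// ler_norm|exists p].
Qed.

(* [2 h(q) + 2 q h'(q)], with [q = |p|^2], is the divergence of the field [h(q) p]. *)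
Lemma integral_radial_divergence h h' (r : R) : smooth h -> smooth h' ->
  (forall s, is_derive s (1 : R) h (h' s)) -> 0 <= r ->
  (forall s, r ^+ 2 <= s -> h s = 0) -> (forall s, r ^+ 2 <= s -> h' s = 0) ->
  (\int[@lebesgue2 R]_p (2 * h (normsq p) + 2 * normsq p * h' (normsq p))%:E = 0)%E.
Proof.
move=> sh sh' dh r0 h0 h'0.
(* [A] and [B] are the partial derivatives of [p.1 h] and [p.2 h]. Each integrates to zero along
   lines parallel to its own axis, so the two double integrals are iterated in opposite orders. *)
pose A (p : R * R) := h (normsq p) + 2 * (p.1 * p.1) * h' (normsq p).
pose B (p : R * R) := h (normsq p) + 2 * (p.2 * p.2) * h' (normsq p).
have sA : smooth2 A.
  apply: smooth2_add (smooth2_radial sh) (smooth2_mul _ (smooth2_radial sh')).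
  by apply: smooth2_mul (smooth2_cst _) (smooth2_mul _ _); exact: smooth2_fst.
have sB : smooth2 B.
  apply: smooth2_add (smooth2_radial sh) (smooth2_mul _ (smooth2_radial sh')).
  by apply: smooth2_mul (smooth2_cst _) (smooth2_mul _ _); exact: smooth2_snd.
have A0 p : ~ square_box r p -> A p = 0.
  by move=> /(not_square_box_normsq r0) rp; rewrite /A h0// h'0// mulr0 addr0.
have B0 p : ~ square_box r p -> B p = 0.
  by move=> /(not_square_box_normsq r0) rp; rewrite /B h0// h'0// mulr0 addr0.
have intg f : smooth2 f -> (forall p, ~ square_box r p -> f p = 0) ->
    (@lebesgue2 R).-integrable setT (EFin \o f).
  move=> sf f0.
  have [C fC] := continuous_square_box_bounded (smooth2_continuous sf) f0.
  exact: integrable_square_box (smooth2_measurable sf) fC f0.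
have line (y : R) : (\int[mu]_x (h (x ^+ 2 + y ^+ 2) + 2 * (x * x) * h' (x ^+ 2 + y ^+ 2))%:E = 0)%E.
  pose g (x : R) : R := h (x ^+ 2 + y ^+ 2) + 2 * (x * x) * h' (x ^+ 2 + y ^+ 2).
  (* Larger than [r], so that the interval is nondegenerate even for [r = 0]. *)
  pose M := r + 1.
  have gM (x : R) : x \notin `[- M, M] -> g x = 0.
    move=> xM; rewrite /g.
    have : r ^+ 2 <= x ^+ 2 + y ^+ 2.
      apply: (not_square_box_normsq (p := (x, y)) r0) => -[/= xr _].
      move/negP: xM; apply; move: xr; rewrite /= !in_itv/= /M => /andP[]; lra.
    by move=> rp; rewrite h0// h'0// mulr0 addr0.
  transitivity (\int[mu]_(x in `[(- M)%R, M]) (g x)%:E)%E.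
    rewrite [RHS]integral_mkcond; apply: eq_integral => x _.
    by rewrite patchE; case: ifPn => //; rewrite notin_setE/= => /negP /gM gx0; congr EFin; exact: gx0.
  have dq (x : R) : is_derive x (1 : R) (fun x : R => x ^+ 2 + y ^+ 2) (2 * x).
    by apply: deriv_eq (deriv_add (deriv_exp 1 (deriv_id x)) (deriv_cst (y ^+ 2) x)) _; ring.
  pose F (x : R) : R := x * h (x ^+ 2 + y ^+ 2).
  have dF (x : R) : is_derive x (1 : R) F (g x).
    apply: deriv_eq (deriv_mul (deriv_id x) (deriv_comp (dh _) (dq x))) _.
    by rewrite /g; ring.
  have cg : continuous g.
    move=> x.
    have ch (k : R -> R) (sk : smooth k) :
        {for x, continuous (fun x : R => k (x ^+ 2 + y ^+ 2))}.
      apply: continuous_comp; first exact: deriv_continuous (dq x).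
      exact: smooth_continuous.
    apply: cvgD; first exact: (ch _ sh).
    apply: cvgM; last exact: (ch _ sh').
    by apply: cvgM; [exact: cvg_cst|apply: cvgM; exact: cvg_id].
  rewrite (@continuous_FTC2 _ _ F).
  - rewrite /F h0 ?h0 /M; first by rewrite !mulr0 subee.
      by have := sqr_ge0 y; nra.
    by have := sqr_ge0 y; nra.
  - by rewrite /M; lra.
  - exact: continuous_subspaceT.
  - split.
    + by move=> x _; exact: ex_derive.
    + apply: cvg_at_right_filter; exact: (deriv_continuous (dF _)).
    + apply: cvg_at_left_filter; exact: (deriv_continuous (dF _)).
  - by move=> x _; rewrite derive1E; exact: derive_val.
transitivity (\int[@lebesgue2 R]_p ((A p)%:E + (B p)%:E))%E.
  by apply: eq_integral => p _; rewrite -EFinD; congr EFin; rewrite /A /B /normsq; ring.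
rewrite integralD//; [|exact: intg..].
rewrite -(integral21_prod_meas1 (intg _ sA A0)) -(integral12_prod_meas1 (intg _ sB B0)).
rewrite !integral0_eq ?adde0// => y _.
- rewrite /fubini_F -[RHS](line y); apply: eq_integral => x _.
  by rewrite /B /normsq/= [y ^+ 2 + _]addrC.
- by rewrite /fubini_G -[RHS](line y); apply: eq_integral.
Qed.

End PlaneIntegration.

(** * The Rayleigh equation across a thin annulus *)

Section Contraction.
Context {R : realType} (T : Type).
Implicit Types (u v : T -> R).

Lemma half_expn_le (K e : R) : 0 < e -> exists n, K * 2^-1 ^+ n <= e.
Proof.
move=> e0.
have [n nK] : exists n : nat, K / e <= n%:R.
  by exists (Num.bound `|K / e|); apply: le_trans (ler_norm _) _; exact/ltW/archi_boundP.
exists n; rewrite exprVn ler_pdivrMr ?exprn_gt0// mulrC -ler_pdivrMr//.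
by apply: le_trans nK _; rewrite -natrX ler_nat ltnW// ltn_expl.
Qed.

(* The limit of the iterates [u n] is built as the supremum of the lower bounds
   [u n - 2 M0 / 2^n], which is uniform in the argument. *)
Lemma uniform_contraction_fixpoint (S : set (T -> R)) (Phi : (T -> R) -> T -> R)
    (u0 : T -> R) (M0 : R) :
  S u0 -> (forall u, S u -> S (Phi u)) ->
  (forall u v M, S u -> S v -> (forall t, `|u t - v t| <= M) ->
     forall t, `|Phi u t - Phi v t| <= M * 2^-1) ->
  (forall t, `|Phi u0 t - u0 t| <= M0) ->
  (forall u, (forall e, 0 < e -> exists2 v, S v & forall t, `|v t - u t| <= e) -> S u) ->
  exists2 u, S u & forall t, Phi u t = u t.
Proof.
move=> Su0 SPhi contr uM0 closedS.
pose w n := iter n Phi u0.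
have Sw n : S (w n) by elim: n => // n IH; exact: SPhi.
pose d n : R := M0 * 2^-1 ^+ n.
have wd n t : `|w n.+1 t - w n t| <= d n.
  elim: n t => [|n IH] t; first by rewrite /d expr0 mulr1; exact: uM0.
  by rewrite /d exprSr mulrA; exact: (contr _ _ _ (Sw n.+1) (Sw n) IH).
have dS n : d n = 2 * d n.+1 by rewrite /d exprS; field.
have lo n m t : w n t - 2 * d n <= w (n + m)%N t - 2 * d (n + m)%N.
  elim: m => [|m IH]; first by rewrite addn0.
  apply: le_trans IH _; rewrite addnS; have := wd (n + m)%N t; rewrite ler_norml => /andP[].
  by have := dS (n + m)%N; lra.
have hi n m t : w (n + m)%N t + 2 * d (n + m)%N <= w n t + 2 * d n.
  elim: m => [|m IH]; first by rewrite addn0.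
  apply: le_trans _ IH; rewrite addnS; have := wd (n + m)%N t; rewrite ler_norml => /andP[].
  by have := dS (n + m)%N; lra.
have d0 n (t : T) : 0 <= d n by apply: le_trans (wd n t).
have lohi n m t : w n t - 2 * d n <= w m t + 2 * d m.
  have := lo n m t; have := hi m n t; rewrite addnC; have := d0 (n + m)%N t; lra.
pose A t := [set w n t - 2 * d n | n in [set: nat]].
pose u t := sup (A t).
have uw n t : `|w n t - u t| <= 2 * d n.
  have A0 : A t !=set0 by exists (w 0%N t - 2 * d 0%N); exists 0%N.
  have Aub m : ubound (A t) (w m t + 2 * d m) by move=> _ [k _ <-]; exact: lohi.
  have uhi : u t <= w n t + 2 * d n by exact: ge_sup.
  have ulo : w n t - 2 * d n <= u t.
    by apply: ub_le_sup; [exists (w 0%N t + 2 * d 0%N)|exists n].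
  by rewrite ler_norml; apply/andP; split; lra.
have Su : S u.
  apply: closedS => e e0.
  have [n ne] := half_expn_le (2 * M0) e0.
  by exists (w n) => // t; apply: le_trans (uw n t) _; rewrite /d mulrA.
exists u => // t; apply/eqP; rewrite -subr_eq0 -normr_le0; apply/ler_addgt0Pr => e e0; rewrite add0r.
have [n ne] := half_expn_le (2 * M0) e0.
have h1 := contr _ _ _ (Sw n) Su (uw n) t.
have h2 := uw n.+1 t.
have -> : Phi u t - u t = (w n.+1 t - u t) - (Phi (w n) t - Phi u t).
  by rewrite /w iterS; ring.
apply: le_trans (ler_normB _ _) _.
by move: h1 h2 ne; rewrite -(mulrA 2) -/(d n) (dS n); lra.
Qed.

End Contraction.

(** * Integrals normalized at radius 1, and the mean value inequality *)

Section Antiderivative.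
Context {R : realType}.
Local Notation mu := (@lebesgue_measure R).
Implicit Types (f F : R -> R).

(** Based at 0 and then shifted to vanish at 1: the radius 1 is interior to the domain of
    integration, so the derivative there is two-sided. *)
Definition antiderivative f (x : R) : R :=
  \int[mu]_(t in `[0, x]) f t - \int[mu]_(t in `[0, 1]) f t.

Lemma antiderivative1 f : antiderivative f 1 = 0.
Proof. exact: subrr. Qed.

Lemma deriv_antiderivative f (x : R) : continuous f -> 0 < x ->
  is_derive x (1 : R) (antiderivative f) (f x).
Proof.
move=> cf x0.
have xx1 : x < x + 1 by lra.
have fi : mu.-integrable `[0, x + 1] (EFin \o f).
  by apply: continuous_compact_integrable; [exact: segment_compact|exact: continuous_subspaceT].
have [d1 d2] := continuous_FTC1_closed xx1 fi x0 (cf x).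
have dI : is_derive x (1 : R) (fun y : R => \int[mu]_(t in `[0, y]) f t) (f x).
  by apply: DeriveDef; [exact: d1|rewrite -derive1E; exact: d2].
by have := deriv_add dI (deriv_cst (- \int[mu]_(t in `[0, 1]) f t) x); rewrite addr0.
Qed.

Lemma deriv_lipschitz F f (a b L : R) : (forall x : R, a <= x <= b -> is_derive x (1 : R) F (f x)) ->
  (forall x, a <= x <= b -> `|f x| <= L) ->
  forall x y, a <= x <= b -> a <= y <= b -> `|F x - F y| <= L * `|x - y|.
Proof.
move=> dF fL x y; wlog : x y / x <= y => [W xab yab|xy /andP[ax xb] /andP[ay yb]].
  have [xy|/ltW yx] := leP x y; first exact: W.
  by rewrite distrC (distrC x); exact: W.
have [||c] := @MVT_segment R F f x y xy.
- by move=> z; rewrite in_itv/= => /andP[xz zy]; apply: dF; apply/andP; split; lra.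
- apply: continuous_in_subspaceT => z; rewrite inE/= in_itv/= => /andP[xz zy].
  by apply: deriv_continuous; apply: dF; apply/andP; split; lra.
rewrite in_itv/= => /andP[xc cy] FE; rewrite distrC FE (distrC x) normrM.
by apply: ler_wpM2r => //; apply: fL; apply/andP; split; lra.
Qed.

End Antiderivative.

(** * Joint size and Lipschitz estimates for the rates *)

Section LipschitzBounds.
Context {R : realType}.
Implicit Types (K M s t x : R).

(** One constant controls both size and Lipschitz ratio, so estimates compose through sums and
    products. [M] measures the distance of the inputs: two states for the contraction, two radii for
    continuity, and [M = 0] to extract a plain bound. *)
Definition lipb K M s t := [/\ 0 <= M, `|s| <= K, `|t| <= K & `|s - t| <= K * M].

Lemma lipb_ge0 K M s t : lipb K M s t -> 0 <= K.
Proof. by move=> [_ sK _ _]; apply: le_trans sK. Qed.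

Lemma lipb_le K K' M s t : K <= K' -> lipb K M s t -> lipb K' M s t.
Proof.
move=> KK' [M0 sK tK stK]; split=> //; [exact: le_trans KK'|exact: le_trans KK'|].
by apply: le_trans stK _; exact: ler_wpM2r.
Qed.

Lemma lipb_refl K M c : 0 <= M -> `|c| <= K -> lipb K M c c.
Proof.
move=> M0 cK; have K0 : 0 <= K by apply: le_trans cK.
by split=> //; rewrite subrr normr0 mulr_ge0.
Qed.

Lemma lipb_close K M s t : 1 <= K -> `|s| <= K -> `|t| <= K -> `|s - t| <= M -> lipb K M s t.
Proof.
move=> K1 sK tK st; have M0 : 0 <= M by apply: le_trans st.
by split=> //; apply: le_trans st _; rewrite ler_peMl.
Qed.

Lemma lipb_opp K M s t : lipb K M s t -> lipb K M (- s) (- t).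
Proof. by move=> [M0 ? ? ?]; split=> //; rewrite ?normrN// -opprD normrN. Qed.

Lemma lipb_add K K' M s t s' t' : lipb K M s t -> lipb K' M s' t' ->
  lipb (K + K') M (s + s') (t + t').
Proof.
move=> [M0 sK tK st] [_ sK' tK' st']; split=> //.
- by apply: le_trans (ler_normD _ _) _; exact: lerD.
- by apply: le_trans (ler_normD _ _) _; exact: lerD.
- by rewrite opprD addrACA mulrDl; apply: le_trans (ler_normD _ _) _; exact: lerD.
Qed.

Lemma lipb_mul K K' M s t s' t' : lipb K M s t -> lipb K' M s' t' ->
  lipb (2 * (K * K')) M (s * s') (t * t').
Proof.
move=> a1 a2; have K0 := lipb_ge0 a1; have K'0 := lipb_ge0 a2.
move: a1 a2 => [M0 sK tK st] [_ sK' tK' st'].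
have KK' : 0 <= K * K' by rewrite mulr_ge0.
split=> //.
- by rewrite normrM; apply: le_trans (ler_pM _ _ sK sK') _ => //; lra.
- by rewrite normrM; apply: le_trans (ler_pM _ _ tK tK') _ => //; lra.
- have -> : s * s' - t * t' = s * (s' - t') + (s - t) * t' by ring.
  apply: le_trans (ler_normD _ _) _; rewrite !normrM.
  have h1 := ler_pM (normr_ge0 _) (normr_ge0 _) sK st'.
  have h2 := ler_pM (normr_ge0 _) (normr_ge0 _) st tK'.
  by lra.
Qed.

(* [1 / (x - i) = inv_re x + i inv_im x] *)
Definition inv_re x := x / (x ^+ 2 + 1).
Definition inv_im x := (x ^+ 2 + 1)^-1.

Lemma sqr_add1_gt0 x : 0 < x ^+ 2 + 1.
Proof. by have := sqr_ge0 x; lra. Qed.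

Lemma inv_re_bound x : `|inv_re x| <= 1.
Proof.
have x0 := sqr_add1_gt0 x.
rewrite /inv_re normf_div (gtr0_norm x0) ler_pdivrMr// mul1r ler_norml.
by apply/andP; split; nra.
Qed.

Lemma inv_im_bound x : `|inv_im x| <= 1.
Proof.
have x0 := sqr_add1_gt0 x.
rewrite /inv_im normfV (gtr0_norm x0) invf_le1//.
by have := sqr_ge0 x; lra.
Qed.

(** The pole [i] of [1 / (x - i)] is off the real line, so [x] need not be kept away from anything:
    the difference quotient is [(1 - s t) / ((s^2 + 1) (t^2 + 1))], of modulus at most 1. *)
Lemma lipb_inv_re K M s t : lipb K M s t -> lipb (K + 1) M (inv_re s) (inv_re t).
Proof.
move=> l; have K0 := lipb_ge0 l; move: l => [M0 sK tK st].
have b1 : 1 <= K + 1 by lra.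
split=> //; try exact: le_trans (inv_re_bound _) b1.
apply: (@le_trans _ _ `|s - t|); last by apply: le_trans st _; nra.
have s0 := sqr_add1_gt0 s; have t0 := sqr_add1_gt0 t.
have -> : inv_re s - inv_re t = (s - t) * ((1 - s * t) / ((s ^+ 2 + 1) * (t ^+ 2 + 1))).
  by rewrite /inv_re; field; rewrite !gt_eqF.
rewrite normrM ler_piMr// normf_div (gtr0_norm (mulr_gt0 s0 t0)) ler_pdivrMr ?mulr_gt0// mul1r.
have := sqr_ge0 (s * t); have := sqr_ge0 (s + t); have := sqr_ge0 (s - t).
have := sqr_ge0 s; have := sqr_ge0 t.
by rewrite ler_norml => *; apply/andP; split; lra.
Qed.

Lemma lipb_inv_im K M s t : lipb K M s t -> lipb (K + 1) M (inv_im s) (inv_im t).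
Proof.
move=> l; have K0 := lipb_ge0 l; move: l => [M0 sK tK st].
have b1 : 1 <= K + 1 by lra.
split=> //; try exact: le_trans (inv_im_bound _) b1.
apply: (@le_trans _ _ `|s - t|); last by apply: le_trans st _; nra.
have s0 := sqr_add1_gt0 s; have t0 := sqr_add1_gt0 t.
have -> : inv_im s - inv_im t = (s - t) * (- (s + t) / ((s ^+ 2 + 1) * (t ^+ 2 + 1))).
  by rewrite /inv_im; field; rewrite !gt_eqF.
rewrite normrM ler_piMr// normf_div (gtr0_norm (mulr_gt0 s0 t0)) ler_pdivrMr ?mulr_gt0// mul1r.
have := sqr_ge0 (s * t); have := sqr_ge0 (s + 1); have := sqr_ge0 (s - 1).
have := sqr_ge0 (t + 1); have := sqr_ge0 (t - 1).
have := sqr_ge0 s; have := sqr_ge0 t.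
by rewrite ler_norml => *; apply/andP; split; lra.
Qed.

(* With [y = (x - i)^2], these are the real and imaginary parts of [xi / y] and
   of [3 y eta - 2 xi]. *)
Definition eta_rate_re x xi1 xi2 :=
  xi1 * (inv_re x * inv_re x - inv_im x * inv_im x) - xi2 * (2 * (inv_re x * inv_im x)).
Definition eta_rate_im x xi1 xi2 :=
  xi1 * (2 * (inv_re x * inv_im x)) + xi2 * (inv_re x * inv_re x - inv_im x * inv_im x).
Definition xi_rate_re x eta1 eta2 xi1 :=
  3 * ((x * x - 1) * eta1 + 2 * x * eta2) - 2 * xi1.
Definition xi_rate_im x eta1 eta2 xi2 :=
  3 * ((x * x - 1) * eta2 - 2 * x * eta1) - 2 * xi2.

Definition profile a b k : R := b + (a - b) * k.

(* Unknowns of the fixed-point problem: [eta - 1], [xi - (a - i)^2] (real and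
   imaginary parts) and the offsets of [a] and [b] from [7/4] and [-7/12], the
   latter two being functions of the radius of which only the value at 1 counts. *)
Inductive coord := cE1 | cE2 | cZ1 | cZ2 | cA | cB.

Definition rate j (a b e1 e2 z1 z2 k i : R) : R :=
  let x := profile a b k in
  let xi1 := a * a - 1 + z1 in let xi2 := - (2 * a) + z2 in
  (match j with
   | cE1 => eta_rate_re x xi1 xi2
   | cE2 => eta_rate_im x xi1 xi2
   | cZ1 => xi_rate_re x (1 + e1) e2 xi1
   | cZ2 => xi_rate_im x (1 + e1) e2 xi2
   | _ => 0 end) * i.

(** The rates are polynomials in the data and in the bounded functions [inv_re] and [inv_im]. What
    counts is that [L] is fixed before any thickness or profile is chosen; its value is
    irrelevant. *)
Lemma lipb_rate : exists2 L, 0 < L &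
  forall j M a a' b b' e1 e1' e2 e2' z1 z1' z2 z2' k k' i i',
  lipb 2 M a a' -> lipb 2 M b b' -> lipb 2 M e1 e1' -> lipb 2 M e2 e2' ->
  lipb 2 M z1 z1' -> lipb 2 M z2 z2' -> lipb 2 M k k' -> lipb 2 M i i' ->
  lipb L M (rate j a b e1 e2 z1 z2 k i) (rate j a' b' e1' e2' z1' z2' k' i').
Proof.
suff H j : exists L, forall M a a' b b' e1 e1' e2 e2' z1 z1' z2 z2' k k' i i',
  lipb 2 M a a' -> lipb 2 M b b' -> lipb 2 M e1 e1' -> lipb 2 M e2 e2' ->
  lipb 2 M z1 z1' -> lipb 2 M z2 z2' -> lipb 2 M k k' -> lipb 2 M i i' ->
  lipb L M (rate j a b e1 e2 z1 z2 k i) (rate j a' b' e1' e2' z1' z2' k' i').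
  have [L1 H1] := H cE1; have [L2 H2] := H cE2; have [L3 H3] := H cZ1.
  have [L4 H4] := H cZ2; have [L5 H5] := H cA; have [L6 H6] := H cB.
  exists (`|L1| + `|L2| + `|L3| + `|L4| + `|L5| + `|L6| + 1).
    by rewrite ltr_wpDl// !addr_ge0.
  have N1 := ler_norm L1; have N2 := ler_norm L2; have N3 := ler_norm L3.
  have N4 := ler_norm L4; have N5 := ler_norm L5; have N6 := ler_norm L6.
  have P1 := normr_ge0 L1; have P2 := normr_ge0 L2; have P3 := normr_ge0 L3.
  have P4 := normr_ge0 L4; have P5 := normr_ge0 L5; have P6 := normr_ge0 L6.
  move=> j M *; case: j.
  - by apply: (@lipb_le L1); [lra|exact: H1].
  - by apply: (@lipb_le L2); [lra|exact: H2].
  - by apply: (@lipb_le L3); [lra|exact: H3].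
  - by apply: (@lipb_le L4); [lra|exact: H4].
  - by apply: (@lipb_le L5); [lra|exact: H5].
  - by apply: (@lipb_le L6); [lra|exact: H6].
(* The constant stays an existential variable, which unification assembles while the expression tree
   is traversed. *)
case: j; eexists=> M a a' b b' e1 e1' e2 e2' z1 z1' z2 z2' k k' i i' la lb le1 le2 lz1 lz2 lk li;
  have M0 : 0 <= M by case: la.
all: apply: lipb_mul li; rewrite /eta_rate_re /eta_rate_im /xi_rate_re /xi_rate_im /profile;
  repeat match goal with
  | |- lipb _ _ (_ + _) _ => eapply lipb_add
  | |- lipb _ _ (- _) _ => eapply lipb_opp
  | |- lipb _ _ (_ * _) _ => eapply lipb_mul
  | |- lipb _ _ (inv_re _) _ => eapply lipb_inv_re
  | |- lipb _ _ (inv_im _) _ => eapply lipb_inv_im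
  | _ => first [eassumption | eapply (lipb_refl M0 (lexx _))]
  end.
Qed.

End LipschitzBounds.

(** * The fixed-point map: Picard iteration coupled to a Newton step *)

Section LayerSolution.
Context {R : realType}.
Implicit Types (a b h r : R) (k : R -> R) (u v : coord * R -> R).

(** Freezing the radius outside the annulus gives states defined and Lipschitz on the whole line,
    and keeps the factor [1 / r] at most 1. *)
Definition clip (h r : R) := Num.max 1 (Num.min r (1 + h)).

Lemma clip_bounds h r : 0 < h -> 1 <= clip h r <= 1 + h.
Proof.
move=> h0; rewrite /clip le_max lexx/= ge_max ge_min lexx orbT andbT.
by lra.
Qed.

Lemma clip_id h r : 1 <= r <= 1 + h -> clip h r = r.
Proof. by move=> /andP[r1 rh]; rewrite /clip min_l// max_r. Qed.

Lemma clip_lipschitz h r s : `|clip h r - clip h s| <= `|r - s|.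
Proof.
rewrite /clip; have d1 := ler_norm (r - s); have d2 := ler_norm (s - r).
have d0 := normr_ge0 (r - s); rewrite (distrC s r) in d2.
case: (leP r (1 + h)) => ?; case: (leP s (1 + h)) => ?.
all: case: (leP 1 r) => ?; case: (leP 1 s) => ?; case: (leP 1 (1 + h)) => ?.
all: by rewrite ler_norml; apply/andP; split; lra.
Qed.

Lemma lipschitz_continuous (f : R -> R) (L : R) :
  (forall r s, `|f r - f s| <= L * `|r - s|) -> continuous f.
Proof.
move=> fL r; apply/cvgrPdist_le => e e0.
have L0 : 0 < `|L| + 1 by rewrite ltr_wpDl.
near=> s; apply: le_trans (fL _ _) _.
apply: (@le_trans _ _ ((`|L| + 1) * `|r - s|)).
  by apply: ler_wpM2r => //; have := ler_norm L; lra.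
rewrite -ler_pdivlMl//.
near: s; apply: cvgr_dist_le; first exact: cvg_id.
by rewrite mulr_gt0// invr_gt0.
Unshelve. all: end_near. Qed.

(** [7/4] and [-7/12] are rational stand-ins for [sqrt 3] and [- 1 / sqrt 3] for which [a + 3 b = 0]
    is exact; the real part [a^2 - 1 + 3 (b^2 - 1)] is then off by [1/12]. *)
Definition inner_speed u : R := 7 / 4 + u (cA, 1).
Definition outer_speed u : R := - (7 / 12) + u (cB, 1).

Definition state_rate h k u j r :=
  rate j (inner_speed u) (outer_speed u) (u (cE1, r)) (u (cE2, r)) (u (cZ1, r)) (u (cZ2, r))
    (k r) (clip h r)^-1.

Definition picard_step h k u j r := antiderivative (state_rate h k u j) (clip h r).

(** Real part of [z + 3 (b - i)^2 e]: what the outer condition [xi + 3 (b - i)^2 eta = 0] adds to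
    [(a - i)^2 + 3 (b - i)^2] when [eta = 1 + e] and [xi = (a - i)^2 + z]. *)
Definition end_defect_re (b e1 e2 z1 : R) := z1 + 3 * ((b * b - 1) * e1 + 2 * b * e2).
Definition end_defect_im (b e1 e2 z2 : R) := z2 + 3 * ((b * b - 1) * e2 - 2 * b * e1).

(* Newton step, with the Jacobian frozen at [(7/4, -7/12)], for the end conditions
   [a^2 - 1 + 3 (b^2 - 1) + Re D = 0] and [- 2 (a + 3 b) + Im D = 0], where [D] is
   the end defect; [p] and [q] are the offsets of [a] and [b]. *)
Definition newton_a (p q d1 d2 : R) := (- 2^-1 - 6 * (p * p) - 18 * (q * q) - 6 * d1 + 7 / 2 * d2) / 28.
Definition newton_b (p q d1 d2 : R) := (6^-1 + 2 * (p * p) + 6 * (q * q) + 2 * d1 + 7 / 2 * d2) / 28.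

Definition picard_newton h k u (t : coord * R) : R :=
  let s j := picard_step h k u j (1 + h) in
  let d1 := end_defect_re (outer_speed u) (s cE1) (s cE2) (s cZ1) in
  let d2 := end_defect_im (outer_speed u) (s cE1) (s cE2) (s cZ2) in
  match t with
  | (cA, _) => newton_a (u (cA, 1)) (u (cB, 1)) d1 d2
  | (cB, _) => newton_b (u (cA, 1)) (u (cB, 1)) d1 d2
  | (j, r) => picard_step h k u j r
  end.

(** The Lipschitz bound in the radius survives uniform limits and makes the rates continuous, as the
    fundamental theorem of calculus requires at each iterate and at the limit. *)
Definition admissible_state (L : R) : set (coord * R -> R) := [set u |
  (forall t, `|u t| <= 20^-1) /\ (forall j r s, `|u (j, r) - u (j, s)| <= L * `|r - s|)].

Lemma lipb_newton (M p p' q q' d1 d1' d2 d2' : R) :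
  `|p| <= 20^-1 -> `|p'| <= 20^-1 -> `|q| <= 20^-1 -> `|q'| <= 20^-1 -> 0 <= M -> `|p - p'| <= M -> `|q - q'| <= M ->
  lipb 20^-1 M d1 d1' -> lipb 20^-1 M d2 d2' ->
  [/\ `|newton_a p q d1 d2| <= 20^-1, `|newton_b p q d1 d2| <= 20^-1,
    `|newton_a p q d1 d2 - newton_a p' q' d1' d2'| <= M * 2^-1 &
    `|newton_b p q d1 d2 - newton_b p' q' d1' d2'| <= M * 2^-1].
Proof.
move=> p1 p1' q1 q1' M0 pM qM [_ d1K _ d1M] [_ d2K _ d2M].
have sq (x : R) : `|x| <= 20^-1 -> 0 <= x * x <= 400^-1.
  by rewrite ler_norml => /andP[? ?]; apply/andP; split; nra.
have sqd (x y : R) : `|x| <= 20^-1 -> `|y| <= 20^-1 -> `|x - y| <= M ->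
    `|x * x - y * y| <= M / 10.
  move=> x1 y1 xy; have -> : x * x - y * y = (x - y) * (x + y) by ring.
  rewrite normrM; apply: ler_pM => //; apply: le_trans (ler_normD _ _) _; lra.
have := sqd _ _ p1 p1' pM; have := sqd _ _ q1 q1' qM.
have := sq _ p1; have := sq _ q1.
move: d1K d2K d1M d2M; rewrite !ler_norml /newton_a /newton_b.
move=> /andP[? ?] /andP[? ?] /andP[? ?] /andP[? ?] /andP[? ?] /andP[? ?] /andP[? ?] /andP[? ?].
by split; apply/andP; split; lra.
Qed.

(** The composition rules give the constant [85 d], which [1/2000] brings below [1/20]. *)
Lemma lipb_end_defect (M d b b' e1 e1' e2 e2' z1 z1' z2 z2' : R) : 0 <= d <= 2000^-1 ->
  lipb 1 M b b' -> lipb d M e1 e1' -> lipb d M e2 e2' -> lipb d M z1 z1' -> lipb d M z2 z2' ->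
  lipb 20^-1 M (end_defect_re b e1 e2 z1) (end_defect_re b' e1' e2' z1') /\
  lipb 20^-1 M (end_defect_im b e1 e2 z2) (end_defect_im b' e1' e2' z2').
Proof.
move=> /andP[d0 d1] lb le1 le2 lz1 lz2; have M0 : 0 <= M by case: lb.
have lc (c : R) : 0 <= c -> lipb c M c c.
  by move=> c0; apply: lipb_refl => //; rewrite ger0_norm.
have lb2 := lipb_mul (lc 2 (ler0n _ _)) lb.
have lbb := lipb_add (lipb_mul lb lb) (lipb_opp (lc 1 ler01)).
have l3 := lc 3 (ler0n _ _).
split.
- apply: lipb_le (lipb_add lz1 (lipb_mul l3 (lipb_add (lipb_mul lbb le1) (lipb_mul lb2 le2)))).
  by lra.
- apply: lipb_le (lipb_add lz2 (lipb_mul l3 (lipb_add (lipb_mul lbb le2) (lipb_opp (lipb_mul lb2 le1))))).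
  by lra.
Qed.

End LayerSolution.

(** * Existence of the fixed point, with a thickness uniform in the profile *)

Section LayerExistence.
Context {R : realType}.
Implicit Types (a b h r : R) (k : R -> R) (u v : coord * R -> R).

(** Over a layer of thickness [h] the Picard coordinates stay within [L * h] of 0 and contract with
    factor [L * h]; the two speeds then contract by the Newton estimate, whose defects are of the
    same order. *)
Lemma layer_fixpoint : exists2 h : R, 0 < h & forall k, continuous k ->
  (forall r, 0 <= k r <= 1) ->
  exists u, [/\ forall t, `|u t| <= 20^-1, forall j, continuous (state_rate h k u j) &
    forall t, picard_newton h k u t = u t].
Proof.
have [L L0 lip] := @lipb_rate R.
have L10 : 0 < L + 1 by lra.
have [h h0 hL] : exists2 h : R, 0 < h & L * h <= 2000^-1.
  exists ((L + 1)^-1 / 2000); first by rewrite divr_gt0 ?invr_gt0 ?ltr0n.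
  rewrite mulrA ler_pdivrMr ?ltr0n// mulVf ?pnatr_eq0// ler_pdivrMr//; lra.
exists h => // k ck k01.
have clipp r : 0 < clip h r by have := clip_bounds r h0; lra.
have le12 : 1 <= (2 : R) by rewrite ler1n.
have speed_bound u : admissible_state L u -> `|inner_speed u| <= 2 /\ `|outer_speed u| <= 1.
  move=> [uB _]; have := uB (cA, 1); have := uB (cB, 1).
  by rewrite /inner_speed /outer_speed !ler_norml => *; split; lra.
have u2 u : admissible_state L u -> forall t, `|u t| <= 2.
  by move=> [uB _] t; have := uB t; lra.
have k2 r : `|k r| <= 2 by have := k01 r; rewrite ler_norml; lra.
have i2 r : `|(clip h r)^-1| <= 2.
  by rewrite gtr0_norm ?invr_gt0// -[2]invrK lef_pV2 ?posrE ?invr_gt0//; have := clip_bounds r h0; lra.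
have invclip r s : `|(clip h r)^-1 - (clip h s)^-1| <= `|r - s|.
  apply: le_trans (clip_lipschitz h r s).
  have -> : (clip h r)^-1 - (clip h s)^-1 = (clip h s - clip h r) * ((clip h r)^-1 * (clip h s)^-1).
    by field; rewrite !gt_eqF.
  have i1 t : (clip h t)^-1 <= 1 by rewrite invf_le1//; have := clip_bounds t h0; lra.
  have i0 t : 0 < (clip h t)^-1 by rewrite invr_gt0.
  rewrite distrC normrM ler_piMr// gtr0_norm ?mulr_gt0//.
  by apply: mulr_ile1 (i1 r) (i1 s); exact: ltW.
have lip_slope u v M : admissible_state L u -> admissible_state L v -> 0 <= M ->
    (forall t, `|u t - v t| <= M) -> forall j r, lipb L M (state_rate h k u j r) (state_rate h k v j r).
  move=> Su Sv M0 uv j r.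
  have uv2 t : lipb 2 M (u t) (v t).
    exact: lipb_close le12 (u2 _ Su _) (u2 _ Sv _) (uv t).
  have [[ua ub] [va vb]] := (speed_bound _ Su, speed_bound _ Sv).
  apply: lip; do ?exact: uv2.
  - by apply: lipb_close => //; rewrite /inner_speed opprD addrACA subrr add0r; exact: uv.
  - apply: lipb_close => //; [exact: le_trans ub le12|exact: le_trans vb le12|].
    by rewrite /outer_speed opprD addrACA subrr add0r; exact: uv.
  - exact: lipb_refl (k2 r).
  - exact: lipb_refl (i2 r).
have slope_bound u : admissible_state L u -> forall j r, `|state_rate h k u j r| <= L.
  move=> Su j r.
  by have [] // := lip_slope u u 0 Su Su (lexx 0) _ j r; move=> t; rewrite subrr normr0.
have slope_cont u : admissible_state L u -> forall j, continuous (state_rate h k u j).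
  move=> Su j r; apply/cvgrPdist_le => e e0.
  pose M := e / L; have M0 : 0 < M by exact: divr_gt0.
  near=> s.
  have rs : `|r - s| <= M.
    by near: s; apply: cvgr_dist_le => //; exact: cvg_id.
  have rsL : L * `|r - s| <= M.
    by rewrite -ler_pdivlMl//; near: s; apply: cvgr_dist_le; [exact: cvg_id|rewrite mulr_gt0// invr_gt0].
  have krs : `|k r - k s| <= M.
    by near: s; apply: cvgr_dist_le => //; exact: ck.
  have us i : lipb 2 M (u (i, r)) (u (i, s)).
    have [_ uL] := Su.
    exact: lipb_close le12 (u2 _ Su _) (u2 _ Su _) (le_trans (uL _ _ _) rsL).
  have [ua ub] := speed_bound _ Su; have M0' := ltW M0.
  have la : lipb 2 M (inner_speed u) (inner_speed u) by exact: lipb_refl.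
  have lb : lipb 2 M (outer_speed u) (outer_speed u) by apply: lipb_refl => //; exact: le_trans ub le12.
  have lk : lipb 2 M (k r) (k s) by exact: lipb_close.
  have li : lipb 2 M (clip h r)^-1 (clip h s)^-1.
    by apply: lipb_close => //; exact: le_trans (invclip r s) rs.
  have [_ _ _] := lip j _ _ _ _ _ _ _ _ _ _ _ _ _ _ _ _ _ la lb (us cE1) (us cE2) (us cZ1) (us cZ2) lk li.
  by rewrite /M mulrC divfK ?gt_eqF.
have dstep u j r : admissible_state L u -> 0 < r ->
    is_derive r (1 : R) (antiderivative (state_rate h k u j)) (state_rate h k u j r).
  by move=> Su; apply: deriv_antiderivative; exact: slope_cont.
have in11 : 1 <= (1 : R) <= 1 + h by apply/andP; split; lra.
have clip1 r : `|clip h r - 1| <= h.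
  by have := clip_bounds r h0; move=> /andP[c1 ch]; rewrite ger0_norm; lra.
have pos s : 1 <= s <= 1 + h -> 0 < s by move=> /andP[s1 _]; exact: lt_le_trans s1.
have step1 u j r : admissible_state L u -> `|picard_step h k u j r| <= L * h.
  move=> Su; have cr := clip_bounds r h0.
  have := @deriv_lipschitz R (antiderivative (state_rate h k u j)) (state_rate h k u j) 1 (1 + h) L _ _ (clip h r) 1 cr in11.
  rewrite antiderivative1 subr0 => H; apply: le_trans (H _ _) _.
  - by move=> s /pos s0; exact: dstep.
  - by move=> s s1; exact: slope_bound.
  - by apply: ler_wpM2l; [exact: ltW|exact: clip1].
have step_lip u j r s : admissible_state L u -> `|picard_step h k u j r - picard_step h k u j s| <= L * `|r - s|.
  move=> Su; have cr := clip_bounds r h0; have cs := clip_bounds s h0.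
  apply: le_trans (@deriv_lipschitz R (antiderivative (state_rate h k u j)) (state_rate h k u j) 1 (1 + h) L _ _ _ _ cr cs) _.
  - by move=> t /pos t0; exact: dstep.
  - by move=> t t1; exact: slope_bound.
  - by apply: ler_wpM2l; [exact: ltW|exact: clip_lipschitz].
have step_contr u v M j r : admissible_state L u -> admissible_state L v -> (forall t, `|u t - v t| <= M) ->
    lipb (L * h) M (picard_step h k u j r) (picard_step h k v j r).
  move=> Su Sv uv; have M0 : 0 <= M by apply: le_trans (uv (cA, 1)).
  split=> //; [exact: step1|exact: step1|].
  have cr := clip_bounds r h0.
  have := @deriv_lipschitz R (fun s => antiderivative (state_rate h k u j) s - antiderivative (state_rate h k v j) s)
     (fun s => state_rate h k u j s - state_rate h k v j s) 1 (1 + h) (L * M) _ _ (clip h r) 1 cr in11.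
  rewrite !antiderivative1 subr0 subr0 => H; apply: le_trans (H _ _) _.
  - by move=> s /pos s0; apply: deriv_add; [|apply: deriv_opp]; exact: dstep.
  - by move=> s s1; case: (lip_slope u v M Su Sv M0 uv j s).
  - rewrite mulrAC; apply: ler_wpM2r => //; apply: ler_wpM2l; first exact: ltW.
    exact: clip1.
have hL0 : 0 <= L * h <= 2000^-1.
  by apply/andP; split; [apply: mulr_ge0; exact: ltW|exact: hL].
have PhiAB u v M : admissible_state L u -> admissible_state L v -> (forall t, `|u t - v t| <= M) ->
    forall r, [/\ `|picard_newton h k u (cA, r)| <= 20^-1, `|picard_newton h k u (cB, r)| <= 20^-1,
      `|picard_newton h k u (cA, r) - picard_newton h k v (cA, r)| <= M * 2^-1 &
      `|picard_newton h k u (cB, r) - picard_newton h k v (cB, r)| <= M * 2^-1].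
  move=> Su Sv uv r; have M0 : 0 <= M by apply: le_trans (uv (cA, 1)).
  have [uB _] := Su; have [vB _] := Sv.
  have lb : lipb 1 M (outer_speed u) (outer_speed v).
    split; [by []|by case: (speed_bound _ Su)|by case: (speed_bound _ Sv)|].
    by rewrite /outer_speed opprD addrACA subrr add0r mul1r.
  have sc j := step_contr u v M j (1 + h) Su Sv uv.
  have [l1 l2] := lipb_end_defect hL0 lb (sc cE1) (sc cE2) (sc cZ1) (sc cZ2).
  by apply: lipb_newton M0 _ _ l1 l2; [exact: uB|exact: vB|exact: uB|exact: vB|exact: uv|exact: uv].
have L20 : L * h <= 20^-1 by lra.
have L2 : L * h <= 2^-1 by lra.
have SPhi u : admissible_state L u -> admissible_state L (picard_newton h k u).
  move=> Su; split=> [[j r]|j r s].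
    have uu t : `|u t - u t| <= 0 by rewrite subrr normr0.
    have [A B _ _] := PhiAB u u 0 Su Su uu r.
    by case: j => //; apply: le_trans (step1 u _ r Su) L20.
  have LL : 0 <= L * `|r - s| by rewrite mulr_ge0// ltW.
  by case: j; [exact: step_lip|exact: step_lip|exact: step_lip|exact: step_lip
    |rewrite /picard_newton subrr normr0|rewrite /picard_newton subrr normr0].
have contrPhi u v M : admissible_state L u -> admissible_state L v -> (forall t, `|u t - v t| <= M) ->
    forall t, `|picard_newton h k u t - picard_newton h k v t| <= M * 2^-1.
  move=> Su Sv uv [j r]; have M0 : 0 <= M by apply: le_trans (uv (cA, 1)).
  have [_ _ A B] := PhiAB u v M Su Sv uv r.
  have sc i : `|picard_step h k u i r - picard_step h k v i r| <= M * 2^-1.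
    have [_ _ _ H] := step_contr u v M i r Su Sv uv.
    by apply: le_trans H _; rewrite mulrC; apply: ler_wpM2l.
  by case: j => //; exact: sc.
have S0 : admissible_state L (fun=> 0).
  by split=> [t|j r s]; rewrite ?subrr normr0// mulr_ge0// ltW.
have Phi0 t : `|picard_newton h k (fun=> 0) t - 0| <= 20^-1.
  by rewrite subr0; have [H _] := SPhi _ S0; exact: H.
have closedS u : (forall e, 0 < e -> exists2 v, admissible_state L v & forall t, `|v t - u t| <= e) ->
    admissible_state L u.
  move=> uv; split=> [t|j r s]; apply/ler_addgt0Pr => e e0.
    have [v [vB _] vu] := uv e e0.
    rewrite (_ : u t = v t - (v t - u t)); last by ring.
    by apply: le_trans (ler_normB _ _) _; apply: lerD; [exact: vB|exact: vu].
  have [v [_ vL] vu] := uv (e / 2) (divr_gt0 e0 (ltr0Sn R 1)).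
  rewrite (_ : u (j, r) - u (j, s) =
    (v (j, r) - v (j, s)) + ((v (j, s) - u (j, s)) - (v (j, r) - u (j, r)))); last by ring.
  apply: le_trans (ler_normD _ _) _; apply: lerD; first exact: vL.
  apply: le_trans (ler_normB _ _) _.
  by have := vu (j, r); have := vu (j, s); lra.
have [u Su uE] := uniform_contraction_fixpoint S0 SPhi contrPhi Phi0 closedS.
by exists u; split=> //; [case: Su|exact: slope_cont].
Unshelve. all: end_near. Qed.

End LayerExistence.

(** * From the fixed point to the differential system and its matching conditions *)

Section LayerEquations.
Context {R : realType}.
Implicit Types (a b h r : R) (k : R -> R) (u v : coord * R -> R).

(** The lower bound on [eta1] will keep the mode from vanishing, and [b < a] the vortex from being
    trivial. Both follow from the unknowns being at most [1/20] in size. *)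
Lemma layer_solution : exists2 h : R, 0 < h & forall k, continuous k ->
  (forall r, 0 <= k r <= 1) ->
  exists a b : R, exists eta1 eta2 xi1 xi2 : R -> R,
  let x r := profile a b (k r) in
  [/\ b < a, 
     [/\ eta1 1 = 1, eta2 1 = 0, xi1 1 = a * a - 1 & xi2 1 = - (2 * a)],
     [/\ xi1 (1 + h) = - 3 * ((b * b - 1) * eta1 (1 + h) + 2 * b * eta2 (1 + h)) &
         xi2 (1 + h) = - 3 * ((b * b - 1) * eta2 (1 + h) - 2 * b * eta1 (1 + h))],
     (forall r, 1 <= r <= 1 + h -> 2^-1 <= eta1 r) &
     forall r, 1 <= r <= 1 + h ->
     [/\ is_derive r (1 : R) eta1 (eta_rate_re (x r) (xi1 r) (xi2 r) / r),
         is_derive r (1 : R) eta2 (eta_rate_im (x r) (xi1 r) (xi2 r) / r),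
         is_derive r (1 : R) xi1 (xi_rate_re (x r) (eta1 r) (eta2 r) (xi1 r) / r) &
         is_derive r (1 : R) xi2 (xi_rate_im (x r) (eta1 r) (eta2 r) (xi2 r) / r)]].
Proof.
have [h h0 H] := @layer_fixpoint R; exists h => // k ck k01.
have [u [uB cs uE]] := H k ck k01.
have dstep j (r : R) : 0 < r ->
    is_derive r (1 : R) (antiderivative (state_rate h k u j)) (state_rate h k u j r).
  by move=> r0; apply: deriv_antiderivative r0; exact: cs.
have in1h : 1 <= 1 + h <= 1 + h by apply/andP; split; lra.
pose anti j := antiderivative (state_rate h k u j).
have E r j : 1 <= r <= 1 + h -> picard_step h k u j r = u (j, r) -> anti j r = u (j, r).
  by move=> r1 <-; rewrite /picard_step clip_id.
exists (inner_speed u), (outer_speed u), (fun r => 1 + anti cE1 r), (anti cE2),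
  (fun r => inner_speed u * inner_speed u - 1 + anti cZ1 r), (fun r => - (2 * inner_speed u) + anti cZ2 r) => x.
have E1 r : 1 <= r <= 1 + h -> anti cE1 r = u (cE1, r).
  by move=> r1; apply: E => //; exact: (uE (cE1, r)).
have E2 r : 1 <= r <= 1 + h -> anti cE2 r = u (cE2, r).
  by move=> r1; apply: E => //; exact: (uE (cE2, r)).
have Z1 r : 1 <= r <= 1 + h -> anti cZ1 r = u (cZ1, r).
  by move=> r1; apply: E => //; exact: (uE (cZ1, r)).
have Z2 r : 1 <= r <= 1 + h -> anti cZ2 r = u (cZ2, r).
  by move=> r1; apply: E => //; exact: (uE (cZ2, r)).
have slopeE j r : 1 <= r <= 1 + h -> state_rate h k u j r =
    rate j (inner_speed u) (outer_speed u) (anti cE1 r) (anti cE2 r) (anti cZ1 r) (anti cZ2 r) (k r) r^-1.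
  by move=> r1; rewrite /state_rate E1// E2// Z1// Z2// clip_id.
have fA := uE (cA, 1); have fB := uE (cB, 1).
have clipR : clip h (1 + h) = 1 + h by exact: clip_id.
rewrite /= /picard_step clipR -/(anti _) /newton_a /newton_b /end_defect_re /end_defect_im in fA fB.
have pB := uB (cA, 1); have qB := uB (cB, 1).
split.
- by move: pB qB; rewrite /inner_speed /outer_speed !ler_norml; lra.
- by split; rewrite /anti antiderivative1 ?addr0.
- by rewrite -!/(anti _) in fA fB; split; rewrite /inner_speed /outer_speed in fA fB *; lra.
- by move=> r r1; rewrite E1//; have := uB (cE1, r); rewrite ler_norml; lra.
- move=> r r1; have r0 : 0 < r by lra.
  have D j := dstep j r r0.
  split.
  + by apply: deriv_eq (deriv_add (deriv_cst 1 r) (D cE1)) _; rewrite add0r slopeE.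
  + by apply: deriv_eq (D cE2) _; rewrite slopeE.
  + by apply: deriv_eq (deriv_add (deriv_cst _ r) (D cZ1)) _; rewrite add0r slopeE.
  + by apply: deriv_eq (deriv_add (deriv_cst _ r) (D cZ2)) _; rewrite add0r slopeE.
Qed.

End LayerEquations.

(** * Inverting the Biot-Savart kernel *)

Section StreamFunction.
Context {R : realType}.
Local Notation mu := (@lebesgue_measure R).

Lemma deriv_inv_re (x : R -> R) (r d : R) : is_derive r (1 : R) x d ->
  is_derive r (1 : R) (fun s => inv_re (x s)) ((1 - x r ^+ 2) / (x r ^+ 2 + 1) ^+ 2 * d).
Proof.
move=> dx; have x0 := sqr_add1_gt0 (x r).
have x1 : x r ^+ 2 + 1 != 0 by rewrite gt_eqF.
apply: deriv_eq (deriv_mul dx (deriv_inv (f := fun s => x s ^+ 2 + 1) x1 (deriv_add (deriv_exp 1 dx) (deriv_cst 1 r)))) _.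
by field.
Qed.

Lemma deriv_inv_im (x : R -> R) (r d : R) : is_derive r (1 : R) x d ->
  is_derive r (1 : R) (fun s => inv_im (x s)) (- (2 * x r) / (x r ^+ 2 + 1) ^+ 2 * d).
Proof.
move=> dx; have x0 := sqr_add1_gt0 (x r).
have x1 : x r ^+ 2 + 1 != 0 by rewrite gt_eqF.
apply: deriv_eq (deriv_inv (f := fun s => x s ^+ 2 + 1) x1 (deriv_add (deriv_exp 1 dx) (deriv_cst 1 r))) _.
by field.
Qed.

(* For [phi = r (x - i) eta], these are the real and imaginary parts of
   [phi' - m phi / r], where [c = 1 - m]; the Wronskian of [phi] with [r ^ m]
   (here [m = 2] and [m = -2]) is an antiderivative of the moments of [wbar' eta].
   [p] stands for [x' / (2 r)]. *)
Definition flux_re c (x p eta1 eta2 xi1 xi2 : R -> R) (r : R) : R :=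
  c * (x r * eta1 r + eta2 r) + 2 * r ^+ 2 * (p r * eta1 r)
  + (xi1 r * inv_re (x r) - xi2 r * inv_im (x r)).

Definition flux_im c (x p eta1 eta2 xi1 xi2 : R -> R) (r : R) : R :=
  c * (x r * eta2 r - eta1 r) + 2 * r ^+ 2 * (p r * eta2 r)
  + (xi1 r * inv_im (x r) + xi2 r * inv_re (x r)).

(** The system for [eta] and [xi] encodes the Rayleigh equation [(r phi')' - 4 phi / r = r W eta],
    and multiplication by [r^2] or [r^-2] turns its left side into a derivative. [W] is the
    vorticity gradient, where the first two derivatives of [x] reappear. *)
Lemma deriv_flux (x p p' eta1 eta2 xi1 xi2 : R -> R) (r : R) : 0 < r ->
  is_derive r (1 : R) x (2 * r * p r) -> is_derive r (1 : R) p (2 * r * p' r) ->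
  is_derive r (1 : R) eta1 (eta_rate_re (x r) (xi1 r) (xi2 r) / r) ->
  is_derive r (1 : R) eta2 (eta_rate_im (x r) (xi1 r) (xi2 r) / r) ->
  is_derive r (1 : R) xi1 (xi_rate_re (x r) (eta1 r) (eta2 r) (xi1 r) / r) ->
  is_derive r (1 : R) xi2 (xi_rate_im (x r) (eta1 r) (eta2 r) (xi2 r) / r) ->
  let W := 8 * r * p r + 4 * r ^+ 3 * p' r in
  [/\ is_derive r (1 : R) (fun s => s ^+ 3 * flux_re (-1) x p eta1 eta2 xi1 xi2 s)
        (r ^+ 3 * (W * eta1 r)),
      is_derive r (1 : R) (fun s => s ^+ 3 * flux_im (-1) x p eta1 eta2 xi1 xi2 s)
        (r ^+ 3 * (W * eta2 r)),
      is_derive r (1 : R) (fun s => s^-1 * flux_re 3 x p eta1 eta2 xi1 xi2 s)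
        (r^-1 * (W * eta1 r)) &
      is_derive r (1 : R) (fun s => s^-1 * flux_im 3 x p eta1 eta2 xi1 xi2 s)
        (r^-1 * (W * eta2 r))].
Proof.
move=> r0 dx dp de1 de2 dx1 dx2 W.
have rn0 : r != 0 by rewrite gt_eqF.
have x1 : x r ^+ 2 + 1 != 0 by rewrite gt_eqF// sqr_add1_gt0.
have d1 := deriv_inv_re dx; have d2 := deriv_inv_im dx.
have dc := deriv_cst _ r; have did := deriv_id r.
have dre c : is_derive r (1 : R) (flux_re c x p eta1 eta2 xi1 xi2) _ :=
  deriv_add (deriv_add (deriv_mul (dc c) (deriv_add (deriv_mul dx de1) de2))
    (deriv_mul (deriv_mul (dc 2) (deriv_exp 1 did)) (deriv_mul dp de1)))
    (deriv_add (deriv_mul dx1 d1) (deriv_opp (deriv_mul dx2 d2))).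
have dim c : is_derive r (1 : R) (flux_im c x p eta1 eta2 xi1 xi2) _ :=
  deriv_add (deriv_add (deriv_mul (dc c) (deriv_add (deriv_mul dx de2) (deriv_opp de1)))
    (deriv_mul (deriv_mul (dc 2) (deriv_exp 1 did)) (deriv_mul dp de2)))
    (deriv_add (deriv_mul dx1 d2) (deriv_mul dx2 d1)).
rewrite /W; split.
- apply: deriv_eq (deriv_mul (deriv_exp 2 did) (dre _)) _.
  by rewrite /flux_re /eta_rate_re /eta_rate_im /xi_rate_re /xi_rate_im /inv_re /inv_im; field; rewrite rn0 x1.
- apply: deriv_eq (deriv_mul (deriv_exp 2 did) (dim _)) _.
  by rewrite /flux_im /eta_rate_re /eta_rate_im /xi_rate_re /xi_rate_im /inv_re /inv_im; field; rewrite rn0 x1.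
- apply: deriv_eq (deriv_mul (deriv_inv (f := fun s => s) rn0 did) (dre _)) _.
  by rewrite /flux_re /eta_rate_re /eta_rate_im /xi_rate_re /xi_rate_im /inv_re /inv_im; field; rewrite rn0 x1.
- apply: deriv_eq (deriv_mul (deriv_inv (f := fun s => s) rn0 did) (dim _)) _.
  by rewrite /flux_im /eta_rate_re /eta_rate_im /xi_rate_re /xi_rate_im /inv_re /inv_im; field; rewrite rn0 x1.
Qed.

End StreamFunction.

(** * The kernel of mode 2 against a density supported in the layer *)

Section KernelIntegral.
Context {R : realType}.
Local Notation mu := (@lebesgue_measure R).
Variables (b : R) (w : R -> R).
Hypotheses (cw : continuous w) (w0 : forall s, ~ (1 <= s <= b) -> w s = 0).

Let layer s : 1 <= s <= b -> 0 < s. Proof. by move=> /andP[s1 _]; exact: lt_le_trans s1. Qed.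

Let integrand (r s : R) := kernel_K 2 (r / s) * w s.

Lemma min_quotient_l (r s : R) : 0 < r -> r <= s -> Num.min (r / s) ((s / r) ^+ 3) = r / s.
Proof.
move=> r0 rs; have s0 : 0 < s by exact: lt_le_trans rs.
rewrite min_l//; apply: (@le_trans _ _ 1); first by rewrite ler_pdivrMr// mul1r.
by apply: exprn_ege1; rewrite ler_pdivlMr// mul1r.
Qed.

Lemma min_quotient_r (r s : R) : 0 < s -> s <= r -> Num.min (r / s) ((s / r) ^+ 3) = (s / r) ^+ 3.
Proof.
move=> s0 sr; have r0 : 0 < r by exact: lt_le_trans sr.
rewrite min_r//; apply: (@le_trans _ _ 1); last by rewrite ler_pdivlMr// mul1r.
by apply: exprn_ile1; [rewrite divr_ge0// ltW|rewrite ler_pdivrMr// mul1r].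
Qed.

(** Written as a minimum, the kernel is continuous in [s] across [s = r] without a case
    distinction. *)
Lemma kernel2E (r s : R) : 0 < r -> 0 < s ->
  kernel_K 2 (r / s) = 2^-1 * Num.min (r / s) ((s / r) ^+ 3).
Proof.
move=> r0 s0; rewrite /kernel_K ler_pdivrMr// mul1r.
have [rs|/ltW sr] := leP r s; first by rewrite min_quotient_l// expr1.
by rewrite min_quotient_r// -exprVn invfM invrK [s * _]mulrC.
Qed.

Lemma continuous_integrand r s : 0 < r -> 0 < s ->
  {for s, continuous (fun s : R => 2^-1 * Num.min (r / s) ((s / r) ^+ 3) * w s)}.
Proof.
move=> r0 s0; apply: cvgM; last exact: cw.
apply: cvgM; first exact: cvg_cst.
apply: (@continuous_min R R (fun s => r / s) (fun s => (s / r) ^+ 3)).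
- apply: cvgM; first exact: cvg_cst.
  by apply: cvgV; [rewrite gt_eqF|exact: cvg_id].
- exact: (deriv_continuous (deriv_exp 2 (deriv_mul (deriv_id s) (deriv_cst r^-1 s)))).
Qed.

Lemma integrable_layer r : 0 < r -> mu.-integrable `[1, b] (EFin \o integrand r).
Proof.
move=> r0.
apply: (@eq_integrable _ _ _ mu `[1, b]%classic _
  (EFin \o (fun s : R => 2^-1 * Num.min (r / s) ((s / r) ^+ 3) * w s))) => [//|s|].
  by rewrite inE/= in_itv/= => /layer s0; rewrite /integrand kernel2E.
apply: continuous_compact_integrable; first exact: segment_compact.
apply: continuous_in_subspaceT => s; rewrite inE/= in_itv/= => /layer s0.
exact: continuous_integrand.
Qed.

Lemma patch_layer r : (integrand r) \_ `]0, +oo[ = (integrand r) \_ `[1, b].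
Proof.
apply/funext => s; rewrite !patchE !mem_setE !in_itv/= andbT.
case: (boolP (1 <= s <= b)) => [/layer ->//|/negP sb].
by rewrite /integrand w0// mulr0 if_same.
Qed.

Lemma integrable_kernel r : 0 < r -> mu.-integrable `]0, +oo[ (EFin \o integrand r).
Proof.
move=> r0.
have mk (D : set R) (mD : measurable D) :=
  @integrable_mkcond _ _ R mu D (EFin \o integrand r) mD.
apply: (iffRL (mk _ (measurable_itv _))); rewrite restrict_EFin patch_layer -restrict_EFin.
by apply: (iffLR (mk _ (measurable_itv _))); exact: integrable_layer.
Qed.

Lemma Rintegral_deriv (f F : R -> R) (x y : R) : x < y ->
  {within `[x, y], continuous f} -> (forall s, x <= s <= y -> is_derive s (1 : R) F (f s)) ->
  \int[mu]_(s in `[x, y]) f s = F y - F x.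
Proof.
move=> xy cf dF; rewrite /Rintegral (@continuous_FTC2 _ f F)//.
- split.
  + by move=> s; rewrite in_itv/= => /andP[? ?]; apply: ex_derive; apply: dF; apply/andP; split; exact: ltW.
  + apply: cvg_at_right_filter; apply: (deriv_continuous (dF _ _)); rewrite lexx/=; exact: ltW.
  + apply: cvg_at_left_filter; apply: (deriv_continuous (dF _ _)); rewrite lexx andbT; exact: ltW.
- move=> s; rewrite in_itv/= => /andP[? ?]; rewrite derive1E.
  by apply: derive_val; apply: dF; apply/andP; split; exact: ltW.
Qed.

(** The kernel is [r^-3 s^3 / 2] for [s <= r] and [r s^-1 / 2] for [s >= r]: each side needs an
    antiderivative of one moment only, anchored at the end of the layer on that side. *)
Lemma integral_kernel r (F1 F2 : R -> R) : 1 < r < b ->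
  (forall s, 1 <= s <= b -> is_derive s (1 : R) F1 (s ^+ 3 * w s)) ->
  (forall s, 1 <= s <= b -> is_derive s (1 : R) F2 (s^-1 * w s)) ->
  F1 1 = 0 -> F2 b = 0 ->
  \int[mu]_(s in `]0, +oo[) integrand r s = 2^-1 * (r ^- 3 * F1 r - r * F2 r).
Proof.
move=> /andP[r1 rb] dF1 dF2 F11 F2b; have r0 : 0 < r by lra.
rewrite Rintegral_mkcond patch_layer -Rintegral_mkcond.
have := @Rintegral_itvB R (integrand r) (BLeft 1) (BRight b) r (integrable_layer r0).
rewrite !bnd_simp => /(_ (ltW r1) (ltW rb)) /eqP; rewrite subr_eq => /eqP ->.
rewrite Rintegral_itv_obnd_cbnd; last first.
  by apply: integrableS (integrable_layer r0) => //; apply: subset_itvr; rewrite bnd_simp ltW.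
have cint x y : 1 <= x -> {within `[x, y], continuous (fun s : R => 2^-1 * Num.min (r / s) ((s / r) ^+ 3) * w s)}.
  move=> x1; apply: continuous_in_subspaceT => s; rewrite inE/= in_itv/= => /andP[xs _].
  by apply: continuous_integrand => //; lra.
have e1 : {in `[1, r]%classic, integrand r =1 fun s : R => 2^-1 * Num.min (r / s) ((s / r) ^+ 3) * w s}.
  by move=> s; rewrite inE/= in_itv/= => /andP[s1 _]; rewrite /integrand kernel2E//; lra.
have e2 : {in `[r, b]%classic, integrand r =1 fun s : R => 2^-1 * Num.min (r / s) ((s / r) ^+ 3) * w s}.
  by move=> s; rewrite inE/= in_itv/= => /andP[s1 _]; rewrite /integrand kernel2E//; lra.
have i1 : \int[mu]_(s in `[1, r]) integrand r s = 2^-1 * r ^- 3 * F1 r.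
  have D s : 1 <= s <= r -> is_derive s (1 : R) (fun s => 2^-1 * r ^- 3 * F1 s)
      (2^-1 * Num.min (r / s) ((s / r) ^+ 3) * w s).
    move=> /andP[s1 sr]; have s0 : 0 < s by lra.
    have sb : 1 <= s <= b by rewrite s1/=; lra.
    apply: deriv_eq (deriv_mul (deriv_cst _ s) (dF1 s sb)) _.
    by rewrite min_quotient_r//; field; lra.
  have := Rintegral_deriv r1 (cint _ _ (lexx _)) D; rewrite F11 mulr0 subr0 => <-.
  exact: eq_Rintegral.
have i2 : \int[mu]_(s in `[r, b]) integrand r s = - (2^-1 * r * F2 r).
  have D s : r <= s <= b -> is_derive s (1 : R) (fun s => 2^-1 * r * F2 s)
      (2^-1 * Num.min (r / s) ((s / r) ^+ 3) * w s).
    move=> /andP[rs sb]; have s0 : 0 < s by lra.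
    have s1b : 1 <= s <= b by rewrite sb andbT; lra.
    apply: deriv_eq (deriv_mul (deriv_cst _ s) (dF2 s s1b)) _.
    by rewrite min_quotient_l//; field; lra.
  have := Rintegral_deriv rb (cint _ _ (ltW r1)) D; rewrite F2b mulr0 sub0r => <-.
  exact: eq_Rintegral.
by rewrite [X in X + _]i2 [X in _ + X]i1; ring.
Qed.

End KernelIntegral.

(** * The vortex *)

Section Transition.
Context {R : realType}.

Lemma transition_exists (c : R) : 1 < c -> exists k k1 k2 : R -> R,
  [/\ [/\ smooth k, smooth k1 & smooth k2],
      (forall s, is_derive s (1 : R) k (k1 s)) /\ (forall s, is_derive s (1 : R) k1 (k2 s)),
      forall s, 0 <= k s <= 1,
      forall s, s <= 1 -> [/\ k s = 1, k1 s = 0 & k2 s = 0] &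
      forall s, c <= s -> [/\ k s = 0, k1 s = 0 & k2 s = 0]].
Proof.
move=> c1; have [chi [schi chi01 chi1 chi0]] := @smooth_step_exists R.
have c10 : 0 < c - 1 by lra.
pose d := (c - 1)^-1; have d0 : 0 < d by rewrite invr_gt0.
pose k s := chi (d * s + (- d)).
have sk : smooth k by exact: smooth_affine.
have [k1 sk1 dk] := smooth_deriv sk; have [k2 sk2 dk1] := smooth_deriv sk1.
(* The thresholds lie strictly between 1 and [c], so local constancy makes [k1] and [k2] vanish at
   both endpoints as well. *)
have kin (s : R) : s < 1 + (c - 1) / 4 -> k s = 1.
  move=> s1; apply: chi1; have -> : d * s - d = (s - 1) / (c - 1) by rewrite /d; ring.
  by rewrite ler_pdivrMr//; lra.
have kout (s : R) : 1 + (c - 1) * (3 / 4) < s -> k s = 0.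
  move=> s1; apply: chi0; have -> : d * s - d = (s - 1) / (c - 1) by rewrite /d; ring.
  by rewrite ler_pdivlMr//; lra.
have k1in (s : R) : s < 1 + (c - 1) / 4 -> k1 s = 0.
  move=> s1; apply: (deriv_near_cst (c := 1) _ (dk s)).
  by near=> t; apply: kin; near: t; exact: lt_nbhsl.
have k1out (s : R) : 1 + (c - 1) * (3 / 4) < s -> k1 s = 0.
  move=> s1; apply: (deriv_near_cst (c := 0) _ (dk s)).
  by near=> t; apply: kout; near: t; exact: lt_nbhsr.
have k2in (s : R) : s < 1 + (c - 1) / 4 -> k2 s = 0.
  move=> s1; apply: (deriv_near_cst (c := 0) _ (dk1 s)).
  by near=> t; apply: k1in; near: t; exact: lt_nbhsl.
have k2out (s : R) : 1 + (c - 1) * (3 / 4) < s -> k2 s = 0.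
  move=> s1; apply: (deriv_near_cst (c := 0) _ (dk1 s)).
  by near=> t; apply: k1out; near: t; exact: lt_nbhsr.
exists k, k1, k2; split=> // [s|s s1|s cs]; first exact: chi01.
- by split; [apply: kin|apply: k1in|apply: k2in]; lra.
- by split; [apply: kout|apply: k1out|apply: k2out]; lra.
Unshelve. all: end_near. Qed.

End Transition.

(** [I] is [(x - i) eta] with [x = b + O], and [W eta = - 2 w]. The left side is thus
    [2 i (x - i - O) w E = 2 i (b - i) w E]. *)
Lemma eigen_algebra {R : realType} (E : R[i]) (b O W e1 e2 : R) :
  let w := (- 2^-1 * (W * e1) +i* (- 2^-1 * (W * e2)))%C in
  let I := (((b + O) * e1 + e2) +i* ((b + O) * e2 - e1))%C in
  - ('i%C * 2%:R * E * O%:C%C * w) + - ('i%C * E * W%:C%C * I) = (2 +i* (2 * b))%C * (w * E).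
Proof.
move=> w I.
transitivity ((- ('i%C * 2%:R * O%:C%C * w) - 'i%C * W%:C%C * I) * E).
  by move: O%:C%C W%:C%C 'i%C w I => *; ring.
rewrite mulrA; congr (_ * _); rewrite /w /I.
have -> : 2%:R = (2 : R)%:C%C by rewrite rmorph_nat.
by simpc; apply/eqP; rewrite eq_complex/=; apply/andP; split; apply/eqP; field.
Qed.

(** * Smoothness, zero mean and unstable mode of the constructed vortex *)

Section Vortex.
Context {R : realType}.
Local Notation mu := (@lebesgue_measure R).
Variables (h a b : R) (k k1 k2 eta1 eta2 xi1 xi2 : R -> R).
Local Notation rmax := (1 + h).
Let x (r : R) := profile a b (k (r ^+ 2)).
Hypotheses (h0 : 0 < h) (ba : b < a).
Hypotheses (sk : smooth k) (sk1 : smooth k1) (sk2 : smooth k2).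
Hypotheses (dk : forall s, is_derive s (1 : R) k (k1 s))
  (dk1 : forall s, is_derive s (1 : R) k1 (k2 s)).
Hypotheses (kin : forall s, s <= 1 -> [/\ k s = 1, k1 s = 0 & k2 s = 0])
  (kout : forall s, rmax ^+ 2 <= s -> [/\ k s = 0, k1 s = 0 & k2 s = 0]).
Hypotheses (eta1_1 : eta1 1 = 1) (eta2_1 : eta2 1 = 0)
  (xi1_1 : xi1 1 = a * a - 1) (xi2_1 : xi2 1 = - (2 * a))
  (xi1_r : xi1 rmax = - 3 * ((b * b - 1) * eta1 rmax + 2 * b * eta2 rmax))
  (xi2_r : xi2 rmax = - 3 * ((b * b - 1) * eta2 rmax - 2 * b * eta1 rmax))
  (eta1_gt0 : forall r, 1 <= r <= rmax -> 2^-1 <= eta1 r).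
Hypotheses
  (deta1 : forall r, 1 <= r <= rmax -> is_derive r (1 : R) eta1 (eta_rate_re (x r) (xi1 r) (xi2 r) / r))
  (deta2 : forall r, 1 <= r <= rmax -> is_derive r (1 : R) eta2 (eta_rate_im (x r) (xi1 r) (xi2 r) / r))
  (dxi1 : forall r, 1 <= r <= rmax ->
     is_derive r (1 : R) xi1 (xi_rate_re (x r) (eta1 r) (eta2 r) (xi1 r) / r))
  (dxi2 : forall r, 1 <= r <= rmax ->
     is_derive r (1 : R) xi2 (xi_rate_im (x r) (eta1 r) (eta2 r) (xi2 r) / r)).

(** For the angular velocity [o(r) = (a - b) k(r^2)], this is the vorticity [2 o + r o'] in the
    variable [s = r^2]. *)
Let g (s : R) := 2 * ((a - b) * k s) + 2 * s * ((a - b) * k1 s).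
Let g1 (s : R) := 4 * ((a - b) * k1 s) + 2 * s * ((a - b) * k2 s).
Let p (r : R) := (a - b) * k1 (r ^+ 2).
Let p' (r : R) := (a - b) * k2 (r ^+ 2).
Let W (r : R) := 8 * r * p r + 4 * r ^+ 3 * p' r.

Definition vortex_profile (r : R) := g (r ^+ 2).
Definition vortex_velocity (r : R) := r * ((a - b) * k (r ^+ 2)).
(** [eta] is controlled on the annulus only. Since [W] vanishes at both of its ends, clipping the
    argument extends the mode continuously by zero. *)
Definition mode_re (r : R) := - 2^-1 * (W (clip h r) * eta1 (clip h r)).
Definition mode_im (r : R) := - 2^-1 * (W (clip h r) * eta2 (clip h r)).

Lemma deriv_sqr (r : R) : is_derive r (1 : R) (fun s : R => s ^+ 2) (2 * r).
Proof. by apply: deriv_eq (deriv_exp 1 (deriv_id r)) _; ring. Qed.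

Lemma smooth_g : smooth g.
Proof.
apply: smooth_add; apply: smooth_mul.
- exact: smooth_cst.
- exact: smooth_mul (smooth_cst _) sk.
- exact: smooth_mul (smooth_cst _) smooth_id.
- exact: smooth_mul (smooth_cst _) sk1.
Qed.

Lemma smooth_g1 : smooth g1.
Proof.
apply: smooth_add; apply: smooth_mul.
- exact: smooth_cst.
- exact: smooth_mul (smooth_cst _) sk1.
- exact: smooth_mul (smooth_cst _) smooth_id.
- exact: smooth_mul (smooth_cst _) sk2.
Qed.

Lemma deriv_g s : is_derive s (1 : R) g (g1 s).
Proof.
have dc := deriv_cst _ s.
apply: deriv_eq (deriv_add (deriv_mul (dc 2) (deriv_mul (dc (a - b)) (dk s)))
  (deriv_mul (deriv_mul (dc 2) (deriv_id s)) (deriv_mul (dc (a - b)) (dk1 s)))) _.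
by rewrite /g1; ring.
Qed.

Lemma WE r : W r = 2 * r * g1 (r ^+ 2).
Proof. by rewrite /W /g1 /p /p'; ring. Qed.

Lemma W_out r : 0 <= r -> ~ (1 < r < rmax) -> W r = 0.
Proof.
move=> r0 nr; have [K1 K2] : k1 (r ^+ 2) = 0 /\ k2 (r ^+ 2) = 0.
  have [r1|r1] := leP r 1.
    by have [|_ -> ->] := kin (s := r ^+ 2); [rewrite expr_le1|].
  have rr : rmax <= r by rewrite leNgt; apply/negP => rr; apply: nr; rewrite r1 rr.
  have m0 : 0 <= rmax by rewrite addr_ge0 ?ler01 ?(ltW h0).
  by have [|_ -> ->] := kout (s := r ^+ 2); [rewrite lerXn2r// nnegrE|].
by rewrite /W /p /p' K1 K2; ring.
Qed.

Lemma derive_profile r : is_derive r (1 : R) vortex_profile (W r).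
Proof. by apply: deriv_eq (deriv_comp (deriv_g _) (deriv_sqr r)) _; rewrite WE; ring. Qed.

Lemma radius_sqr (q : R * R) : Defs.radius q ^+ 2 = normsq q.
Proof. by rewrite /Defs.radius sqr_sqrtr// addr_ge0 ?sqr_ge0. Qed.

Lemma velocity_ok : angular_velocity vortex_profile vortex_velocity.
Proof.
have D r : is_derive r (1 : R) (fun s => s * vortex_velocity s) (r * vortex_profile r).
  have dkr := deriv_comp (dk _) (deriv_sqr r).
  apply: deriv_eq (deriv_mul (deriv_id r) (deriv_mul (deriv_id r) (deriv_mul (deriv_cst (a - b) r) dkr))) _.
  by rewrite /vortex_profile /g; ring.
split=> [r _|]; first exact: D.
rewrite -[X in _ --> X](mul0r (vortex_velocity 0)).
by apply: cvg_at_right_filter; exact: (deriv_continuous (D 0)).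
Qed.

Lemma continuous_W : continuous W.
Proof.
move=> r; have [g2 _ dg1] := smooth_deriv smooth_g1.
have -> : W = fun r => 2 * r * g1 (r ^+ 2) by apply/funext => s; exact: WE.
exact: (deriv_continuous (deriv_mul (deriv_mul (deriv_cst 2 r) (deriv_id r))
  (deriv_comp (dg1 _) (deriv_sqr r)))).
Qed.

Lemma continuous_clip : continuous (clip h).
Proof. by apply: (lipschitz_continuous (L := 1)) => r s; rewrite mul1r; exact: clip_lipschitz. Qed.

Lemma continuous_eta_clip (e d : R -> R) :
  (forall r, 1 <= r <= rmax -> is_derive r (1 : R) e (d r)) ->
  continuous (fun r => - 2^-1 * (W (clip h r) * e (clip h r))).
Proof.
move=> de r; apply: cvgM; first exact: cvg_cst.
apply: cvgM; (apply: continuous_comp; first exact: continuous_clip).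
  exact: continuous_W.
exact: deriv_continuous (de _ (clip_bounds r h0)).
Qed.

Lemma continuous_mode_re : continuous mode_re. Proof. exact: continuous_eta_clip deta1. Qed.
Lemma continuous_mode_im : continuous mode_im. Proof. exact: continuous_eta_clip deta2. Qed.

Lemma W_clip_out s : ~ (1 <= s <= rmax) -> W (clip h s) = 0.
Proof.
move=> ns; apply: W_out; first by have := clip_bounds s h0; lra.
move=> /andP[c1 c2]; apply: ns; move: c1 c2; rewrite /clip.
have hh := h0.
case: (leP s (1 + h)) => sr; last by rewrite max_r ?ltxx//; lra.
by case: (leP 1 s) => s1; rewrite ?ltxx.
Qed.

Lemma mode_re_out s : ~ (1 <= s <= rmax) -> mode_re s = 0.
Proof. by move=> /W_clip_out; rewrite /mode_re => ->; rewrite mul0r mulr0. Qed.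
Lemma mode_im_out s : ~ (1 <= s <= rmax) -> mode_im s = 0.
Proof. by move=> /W_clip_out; rewrite /mode_im => ->; rewrite mul0r mulr0. Qed.

Lemma radius_ge0 (q : R * R) : 0 <= Defs.radius q.
Proof. exact: sqrtr_ge0. Qed.

Lemma deriv_x r : is_derive r (1 : R) x (2 * r * p r).
Proof.
apply: deriv_eq (deriv_add (deriv_cst b r)
  (deriv_mul (deriv_cst (a - b) r) (deriv_comp (dk _) (deriv_sqr r)))) _.
by rewrite /p; ring.
Qed.

Lemma deriv_p r : is_derive r (1 : R) p (2 * r * p' r).
Proof.
apply: deriv_eq (deriv_mul (deriv_cst (a - b) r) (deriv_comp (dk1 _) (deriv_sqr r))) _.
by rewrite /p'; ring.
Qed.

Let x1 : x 1 = a.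
Proof. by rewrite /x /profile; have [|-> _ _] := kin (s := 1 ^+ 2); [rewrite expr1n|ring]. Qed.
Let xr : x rmax = b.
Proof. by rewrite /x /profile; have [|-> _ _] := kout (s := rmax ^+ 2); [|ring]. Qed.
Let p1 : p 1 = 0.
Proof. by rewrite /p; have [|_ -> _] := kin (s := 1 ^+ 2); [rewrite expr1n|ring]. Qed.
Let pr : p rmax = 0.
Proof. by rewrite /p; have [|_ -> _] := kout (s := rmax ^+ 2); [|ring]. Qed.

(** The inner matching condition anchors [F1] and the outer one [F2]. In [r^-3 F1 - r F2] the parts
    common to both fluxes cancel, and the coefficients [-1] and [3] leave the real part of
    [2 (x - i) eta]. *)
Lemma integral_mode_re r : 1 < r < rmax ->
  \int[mu]_(s in `]0, +oo[) (kernel_K 2 (r / s) * mode_re s) = x r * eta1 r + eta2 r.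
Proof.
move=> r1; have hh := h0; have r0 : r != 0 by rewrite gt_eqF//; lra.
have a1 : a ^+ 2 + 1 != 0 by rewrite gt_eqF// sqr_add1_gt0.
have b1 : b ^+ 2 + 1 != 0 by rewrite gt_eqF// sqr_add1_gt0.
pose F1 s := - 2^-1 * (s ^+ 3 * flux_re (-1) x p eta1 eta2 xi1 xi2 s).
pose F2 s := - 2^-1 * (s^-1 * flux_re 3 x p eta1 eta2 xi1 xi2 s).
have D1 s : 1 <= s <= rmax -> is_derive s (1 : R) F1 (s ^+ 3 * mode_re s).
  move=> s1; have s0 : 0 < s by lra.
  have [D _ _ _] := deriv_flux s0 (deriv_x s) (deriv_p s) (deta1 s1) (deta2 s1) (dxi1 s1) (dxi2 s1).
  by apply: deriv_eq (deriv_mul (deriv_cst _ s) D) _; rewrite /mode_re clip_id// /W; ring.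
have D2 s : 1 <= s <= rmax -> is_derive s (1 : R) F2 (s^-1 * mode_re s).
  move=> s1; have s0 : 0 < s by lra.
  have [_ _ D _] := deriv_flux s0 (deriv_x s) (deriv_p s) (deta1 s1) (deta2 s1) (dxi1 s1) (dxi2 s1).
  by apply: deriv_eq (deriv_mul (deriv_cst _ s) D) _; rewrite /mode_re clip_id// /W; ring.
have Z1 : F1 1 = 0.
  by rewrite /F1 /flux_re x1 p1 eta1_1 eta2_1 xi1_1 xi2_1 /inv_re /inv_im; field.
have Z2 : F2 rmax = 0.
  have rm0 : rmax != 0 by rewrite gt_eqF//; lra.
  by rewrite /F2 /flux_re xr pr xi1_r xi2_r /inv_re /inv_im; field; rewrite rm0 b1.
apply: etrans (integral_kernel continuous_mode_re mode_re_out r1 D1 D2 Z1 Z2) _.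
by rewrite /F1 /F2 /flux_re; field.
Qed.

Lemma integral_mode_im r : 1 < r < rmax ->
  \int[mu]_(s in `]0, +oo[) (kernel_K 2 (r / s) * mode_im s) = x r * eta2 r - eta1 r.
Proof.
move=> r1; have hh := h0; have r0 : r != 0 by rewrite gt_eqF//; lra.
have a1 : a ^+ 2 + 1 != 0 by rewrite gt_eqF// sqr_add1_gt0.
have b1 : b ^+ 2 + 1 != 0 by rewrite gt_eqF// sqr_add1_gt0.
pose F1 s := - 2^-1 * (s ^+ 3 * flux_im (-1) x p eta1 eta2 xi1 xi2 s).
pose F2 s := - 2^-1 * (s^-1 * flux_im 3 x p eta1 eta2 xi1 xi2 s).
have D1 s : 1 <= s <= rmax -> is_derive s (1 : R) F1 (s ^+ 3 * mode_im s).
  move=> s1; have s0 : 0 < s by lra.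
  have [_ D _ _] := deriv_flux s0 (deriv_x s) (deriv_p s) (deta1 s1) (deta2 s1) (dxi1 s1) (dxi2 s1).
  by apply: deriv_eq (deriv_mul (deriv_cst _ s) D) _; rewrite /mode_im clip_id// /W; ring.
have D2 s : 1 <= s <= rmax -> is_derive s (1 : R) F2 (s^-1 * mode_im s).
  move=> s1; have s0 : 0 < s by lra.
  have [_ _ _ D] := deriv_flux s0 (deriv_x s) (deriv_p s) (deta1 s1) (deta2 s1) (dxi1 s1) (dxi2 s1).
  by apply: deriv_eq (deriv_mul (deriv_cst _ s) D) _; rewrite /mode_im clip_id// /W; ring.
have Z1 : F1 1 = 0.
  by rewrite /F1 /flux_im x1 p1 eta1_1 eta2_1 xi1_1 xi2_1 /inv_re /inv_im; field.
have Z2 : F2 rmax = 0.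
  have rm0 : rmax != 0 by rewrite gt_eqF//; lra.
  by rewrite /F2 /flux_im xr pr xi1_r xi2_r /inv_re /inv_im; field; rewrite rm0 b1.
apply: etrans (integral_kernel continuous_mode_im mode_im_out r1 D1 D2 Z1 Z2) _.
by rewrite /F1 /F2 /flux_im; field.
Qed.

Definition mode (r : R) : R[i] := (mode_re r +i* mode_im r)%C.

Lemma mode_out r : ~ (1 <= r <= rmax) -> mode r = 0.
Proof. by move=> nr; rewrite /mode mode_re_out// mode_im_out. Qed.

(** With [e^{2 i theta} = (q.1 + i q.2)^2 / r^2], dividing by the clipped radius makes the mode a
    continuous radial factor times a polynomial. The origin causes no singularity, the mode being
    zero for [r < 1]. *)
Let v1 r := mode_re r / clip h r ^+ 2.
Let v2 r := mode_im r / clip h r ^+ 2.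
Let f1 (q : R * R) := v1 (Defs.radius q) * (q.1 * q.1 - q.2 * q.2)
  - v2 (Defs.radius q) * (2 * (q.1 * q.2)).
Let f2 (q : R * R) := v1 (Defs.radius q) * (2 * (q.1 * q.2))
  + v2 (Defs.radius q) * (q.1 * q.1 - q.2 * q.2).

Lemma mode_angularE q : mode (Defs.radius q) * angular_mode 2 q = (f1 q +i* f2 q)%C.
Proof.
rewrite /f1 /f2 /v1 /v2; have [qr|qr] := boolP (1 <= Defs.radius q <= rmax).
  have r0 : Defs.radius q != 0 by rewrite gt_eqF//; lra.
  rewrite /mode /angular_mode expr2 clip_id//; simpc.
  by apply/eqP; rewrite eq_complex/=; apply/andP; split; apply/eqP; field.
by rewrite mode_out ?mode_re_out ?mode_im_out ?mul0r ?subrr ?addr0//; apply/negP.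
Qed.

Lemma continuous_radius : continuous (@Defs.radius R).
Proof.
move=> q; apply: (@continuous_comp _ _ _ (@normsq R) (@Num.sqrt R) q).
  exact: continuous_normsq.
exact: sqrt_continuous.
Qed.

Lemma continuous_div_clip (u : R -> R) : continuous u -> continuous (fun r => u r / clip h r ^+ 2).
Proof.
move=> cu r; apply: cvgM; first exact: cu.
apply: cvgV; first by rewrite expf_neq0// gt_eqF//; have := clip_bounds r h0; lra.
apply: (@continuous_comp _ _ _ (clip h) (fun t : R => t ^+ 2)).
  exact: continuous_clip.
exact: exprn_continuous.
Qed.

Lemma L2_mode : L2 (fun q => mode (Defs.radius q) * angular_mode 2 q).
Proof.
have cv1 := continuous_div_clip continuous_mode_re.
have cv2 := continuous_div_clip continuous_mode_im.
have mr : measurable_fun setT (@Defs.radius R).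
  apply: measurableT_comp measurable_normsq.
  by apply: continuous_measurable_fun; exact: sqrt_continuous.
have mv (v : R -> R) : continuous v -> measurable_fun setT (fun q : R * R => v (Defs.radius q)).
  by move=> cv; apply: measurableT_comp mr; exact: continuous_measurable_fun.
have cvr (v : R -> R) : continuous v -> continuous (fun q : R * R => v (Defs.radius q)).
  move=> cv q; apply: (@continuous_comp _ _ _ (@Defs.radius R) v q); first exact: continuous_radius.
  exact: cv.
have s1 : smooth2 (fun q : R * R => q.1 * q.1 + (-1) * (q.2 * q.2)).
  apply: smooth2_add; first exact: smooth2_mul smooth2_fst smooth2_fst.
  exact: smooth2_mul (smooth2_cst _) (smooth2_mul smooth2_snd smooth2_snd).
have s2 : smooth2 (fun q : R * R => 2 * (q.1 * q.2)).
  exact: smooth2_mul (smooth2_cst _) (smooth2_mul smooth2_fst smooth2_snd).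
have e1 : (fun q : R * R => q.1 * q.1 - q.2 * q.2) = (fun q : R * R => q.1 * q.1 + (-1) * (q.2 * q.2)).
  by apply/funext => q; rewrite mulN1r.
have m1 : measurable_fun setT (fun q : R * R => q.1 * q.1 - q.2 * q.2).
  by rewrite e1; exact: smooth2_measurable.
have c1 : continuous (fun q : R * R => q.1 * q.1 - q.2 * q.2).
  by rewrite e1; exact: smooth2_continuous.
have m2 := smooth2_measurable s2; have c2 := smooth2_continuous s2.
have out q : ~ square_box rmax q -> v1 (Defs.radius q) = 0 /\ v2 (Defs.radius q) = 0.
  move=> nq; have hh := h0; have := @not_square_box_normsq R rmax q _ nq.
  move=> /(_ _)/wrap[]; first by lra.
  rewrite -radius_sqr => nr.
  have [qr|qr] := boolP (1 <= Defs.radius q <= rmax); last first.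
    by rewrite /v1 /v2 mode_re_out ?mode_im_out ?mul0r//; apply/negP.
  (* Leaving the box only gives radius at least [rmax]; the case of equality is settled by
     [W rmax = 0]. *)
  have er : Defs.radius q = rmax.
    apply/eqP; rewrite eq_le; case/andP: qr => _ ->/=.
    by rewrite -(@ler_pXn2r _ 2)// nnegrE; [lra|exact: radius_ge0].
  have rr : 1 <= rmax <= rmax by apply/andP; split; lra.
  have W0 : W rmax = 0 by apply: W_out; [lra|rewrite ltxx andbF].
  by rewrite er /v1 /v2 /mode_re /mode_im clip_id// W0 !mul0r mulr0 mul0r.
have l2 (f : R * R -> R) : measurable_fun setT f -> continuous f ->
    (forall q, ~ square_box rmax q -> f q = 0) -> f \in Lfun (@lebesgue2 R) 2%:E.
  move=> mf cf f0; have [C fC] := continuous_square_box_bounded cf f0.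
  exact: Lfun2_square_box mf fC f0.
split.
- rewrite (_ : (fun q => _) = f1); last by apply/funext => q; rewrite mode_angularE.
  apply: l2.
  + by apply: measurable_funB; apply: measurable_funM => //; exact: mv.
  + by move=> q; apply: cvgB; apply: cvgM; [exact: cvr|exact: c1|exact: cvr|exact: c2].
  + by move=> q /out [z1 z2]; rewrite /f1 z1 z2 !mul0r subrr.
- rewrite (_ : (fun q => _) = f2); last by apply/funext => q; rewrite mode_angularE.
  apply: l2.
  + by apply: measurable_funD; apply: measurable_funM => //; exact: mv.
  + by move=> q; apply: cvgD; apply: cvgM; [exact: cvr|exact: c2|exact: cvr|exact: c1].
  + by move=> q /out [z1 z2]; rewrite /f2 z1 z2 !mul0r addr0.
Qed.

Lemma kernel_integrandE r s : kernel_integrand 2 mode r s =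
  (kernel_K 2 (r / s) * mode_re s +i* (kernel_K 2 (r / s) * mode_im s))%C.
Proof. by rewrite /kernel_integrand /mode; simpc. Qed.

Lemma mode_integrable r : 0 < r -> complex_integrable `]0, +oo[ (kernel_integrand 2 mode r).
Proof.
move=> r0; split.
- rewrite (_ : (fun s => _) = EFin \o (fun s => kernel_K 2 (r / s) * mode_re s)).
    exact: (integrable_kernel continuous_mode_re mode_re_out r0).
  by apply/funext => s; rewrite kernel_integrandE.
- rewrite (_ : (fun s => _) = EFin \o (fun s => kernel_K 2 (r / s) * mode_im s)).
    exact: (integrable_kernel continuous_mode_im mode_im_out r0).
  by apply/funext => s; rewrite kernel_integrandE.
Qed.

Lemma mode_integral r : 1 < r < rmax ->
  complex_integral `]0, +oo[ (kernel_integrand 2 mode r) =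
  ((x r * eta1 r + eta2 r) +i* (x r * eta2 r - eta1 r))%C.
Proof.
move=> r1; rewrite /complex_integral -integral_mode_re// -integral_mode_im//.
by congr (_ +i* _)%C; apply: eq_Rintegral => s _; rewrite kernel_integrandE.
Qed.

(** Outside the open annulus the vorticity gradient and the mode both vanish, so the Biot-Savart
    integral is evaluated only inside it. *)
Lemma eigen_equation q : L_mode 2 vortex_profile vortex_velocity mode q =
  (2 +i* (2 * b))%C * (mode (Defs.radius q) * angular_mode 2 q).
Proof.
rewrite /L_mode /T_mode /K_mode; set E := angular_mode 2 q; set r := Defs.radius q.
have dW : derive1 vortex_profile r = W r by rewrite derive1E; have [_ ->] := derive_profile r.
rewrite dW; have rp : 0 <= r by exact: radius_ge0.
have [r1|/negP nr] := boolP (1 < r < rmax); last first.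
  have W0 : W r = 0 by exact: W_out.
  have m0 : mode r = 0.
    have [r1|/negP r1] := boolP (1 <= r <= rmax); last exact: mode_out.
    by rewrite /mode /mode_re /mode_im clip_id// W0 !mul0r mulr0.
  by rewrite W0 m0 !(mul0r, mulr0, oppr0, addr0).
have rn0 : r != 0 by rewrite gt_eqF//; lra.
have r2 : 1 <= r <= rmax by apply/andP; split; lra.
rewrite mode_integral// [vortex_velocity r / r](_ : _ = (a - b) * k (r ^+ 2)); last first.
  by rewrite /vortex_velocity mulrAC divff// mul1r.
rewrite /mode /mode_re /mode_im clip_id//.
exact: eigen_algebra.
Qed.

(** Otherwise [g] would be constant across the layer, whereas it falls from [2 (a - b) > 0] to 0. *)
Lemma g1_neq0 : exists2 s, 1 < s < rmax ^+ 2 & g1 s != 0.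
Proof.
have hh := h0; have bb := ba; have rm1 : 1 < rmax ^+ 2 by nra.
have [[s gs]|ng] := pselect (exists s, g1 s != 0).
  exists s => //; apply/andP; split; rewrite ltNge; apply: contra gs.
    by move=> /kin[_ K1 K2]; rewrite /g1 K1 K2 !mulr0 addr0.
  by move=> /kout[_ K1 K2]; rewrite /g1 K1 K2 !mulr0 addr0.
have g10 s : g1 s = 0 by apply/eqP/negPn/negP => gs; apply: ng; exists s.
have i1 : 1 <= (1 : R) <= rmax ^+ 2 by rewrite lexx/= ltW.
have i2 : 1 <= rmax ^+ 2 <= rmax ^+ 2 by rewrite lexx andbT ltW.
have g1le (s : R) : 1 <= s <= rmax ^+ 2 -> `|g1 s| <= 0 by rewrite g10 normr0.
have [k1E k11 _] := kin (lexx 1); have [kr k1r _] := kout (lexx (rmax ^+ 2)).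
have := deriv_lipschitz (fun s _ => deriv_g s) g1le i1 i2.
by rewrite mul0r normr_le0 subr_eq0 /g k1E k11 kr k1r => /eqP; lra.
Qed.

Lemma mode_angular_neq0 q : g1 (normsq q) != 0 -> mode (Defs.radius q) * angular_mode 2 q != 0.
Proof.
move=> gq; have hh := h0; set r := Defs.radius q.
have rE : r ^+ 2 = normsq q := radius_sqr q.
have Wr : W r = 2 * r * g1 (normsq q) by rewrite WE rE.
have rp : 0 <= r := radius_ge0 q.
have r0 : r != 0.
  apply: contra gq => /eqP rz; have [|_ K1 K2] := kin (s := normsq q).
    by rewrite -rE rz expr0n.
  by rewrite /g1 K1 K2 !mulr0 addr0.
have W0 : W r != 0 by rewrite Wr !mulf_neq0// pnatr_eq0.
have r1 : 1 < r < rmax by apply/negPn/negP => /negP nr; move: W0; rewrite W_out ?eqxx.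
have r2 : 1 <= r <= rmax by apply/andP; split; lra.
apply: mulf_neq0.
  rewrite eq_complex/= negb_and; apply/orP; left.
  rewrite /mode_re clip_id// !mulf_neq0// ?oppr_eq0 ?invr_eq0 ?pnatr_eq0// gt_eqF//.
  by apply: lt_le_trans (eta1_gt0 r2); rewrite invr_gt0.
rewrite expf_neq0// eq_complex/= negb_and -negb_and; apply/negP => /andP[/eqP X /eqP Y].
have : normsq q = 0.
  have z (t : R) : t / r = 0 -> t = 0 by move=> /eqP; rewrite mulf_eq0 invr_eq0 (negbTE r0) orbF => /eqP.
  by rewrite /normsq (z _ X) (z _ Y) expr0n addr0.
by rewrite -rE => /eqP; rewrite expf_eq0/= (negbTE r0).
Qed.

(** The mode is nonzero wherever [g1 (normsq q)] is, an open condition that holds at some point.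
    Balls are sup-norm squares, so a product of two intervals of positive length fits into one. *)
Lemma mode_not_ae0 :
  ~ {ae @lebesgue2 R, forall q, mode (Defs.radius q) * angular_mode 2 q = 0}.
Proof.
move=> ae0; have [s0 /andP[s1 _] gs0] := g1_neq0.
pose q0 : R * R := (Num.sqrt s0, 0).
have q0E : normsq q0 = s0 by rewrite /normsq/= sqr_sqrtr ?expr0n ?addr0//; lra.
have : \forall q \near q0, g1 (normsq q) != 0.
  have cq : {for q0, continuous (fun q : R * R => g1 (normsq q))}.
    apply: (@continuous_comp _ _ _ (@normsq R) g1); first exact: continuous_normsq.
    exact: (smooth_continuous smooth_g1).
  by apply: cvgr_neq0 cq _; rewrite q0E.
move=> /nbhs_ballP[e/= e0 He].
pose I (c : R) : set R := `[c - e / 2, c + e / 2]%classic.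
pose B : set (R * R) := I (Num.sqrt s0) `*` I 0.
have inb (c t : R) : I c t -> ball c e t.
  rewrite /I/= in_itv/= => /andP[? ?]; rewrite /ball/= ltr_norml; apply/andP; split; lra.
have mI c : measurable (I c) by exact: measurable_itv.
have muI c : mu (I c) = e%:E.
  rewrite /I lebesgue_measure_itv/= lte_fin ifT; last by lra.
  by rewrite -EFinD; congr EFin; lra.
have mB : measurable B by exact: measurableX.
have nB : (@lebesgue2 R).-negligible B.
  apply: negligibleS ae0 => -[t1 t2] [/= /inb b1 /inb b2] /= w0.
  have := @mode_angular_neq0 (t1, t2); rewrite w0 eqxx => /(_ _)/wrap[] //.
  exact: He.
have B0 : (mu \x mu)%E B = 0%E by apply: measure_negligible; [exact: mB|exact: nB].
have BE : (mu \x mu)%E B = (mu (I (Num.sqrt s0)) * mu (I 0%R))%E.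
  by apply: product_measure1E; exact: mI.
by move: BE; rewrite B0 !muI -EFinM => -[] /esym/eqP; rewrite mulf_eq0 gt_eqF.
Qed.

Lemma vortex_unstable : unstable_vortex (fun q => g (normsq q)).
Proof.
exists vortex_profile, vortex_velocity; split.
- by move=> q; rewrite /vortex_profile radius_sqr.
- exact: velocity_ok.
exists 2; split=> //.
exists (fun q => mode (Defs.radius q) * angular_mode 2 q), mode, (2 +i* (2 * b))%C; split.
- by split; [exact: L2_mode|apply: aeW].
- exact: mode_not_ae0.
- exact: mode_integrable.
- by rewrite /= ltr0n.
- by apply: aeW => q; exact: eigen_equation.
Qed.

Lemma vortex_Cc_infty : Cc_infty (fun q => g (normsq q)).
Proof.
have hh := h0; have rm0 : 0 <= rmax by lra.
have gout s : rmax ^+ 2 <= s -> g s = 0.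
  by move=> /kout[K K1 _]; rewrite /g K K1 !mulr0 addr0.
exact: Cc_infty_radial smooth_g gout rm0.
Qed.

(** The vorticity is the divergence of the compactly supported field [(a - b) k(|q|^2) q]. *)
Lemma vortex_mean0 : (\int[@lebesgue2 R]_q (g (normsq q))%:E = 0)%E.
Proof.
have hh := h0.
have rm0 : 0 <= rmax by lra.
have sH : smooth (fun s => (a - b) * k s) by exact: smooth_mul (smooth_cst _) sk.
have sH1 : smooth (fun s => (a - b) * k1 s) by exact: smooth_mul (smooth_cst _) sk1.
have dH s : is_derive s (1 : R) (fun s => (a - b) * k s) ((a - b) * k1 s).
  by apply: deriv_eq (deriv_mul (deriv_cst (a - b) s) (dk s)) _; ring.
have H0 s : rmax ^+ 2 <= s -> (a - b) * k s = 0 by move=> /kout[-> _ _]; rewrite mulr0.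
have H10 s : rmax ^+ 2 <= s -> (a - b) * k1 s = 0 by move=> /kout[_ -> _]; rewrite mulr0.
exact: integral_radial_divergence sH sH1 dH rm0 H0 H10.
Qed.

End Vortex.

Theorem theorem2p3 (R : realType) :
  exists Omega : R * R -> R,
    [/\ Cc_infty Omega,
        (\int[@lebesgue2 R]_x (Omega x)%:E = 0)%E &
        unstable_vortex Omega].
Proof.
have [h h0 layer] := @layer_solution R.
(* The transition is taken in the squared radius, for smoothness at the origin, so it must end at
   [(1 + h)^2]. *)
have c1 : 1 < (1 + h) ^+ 2 by nra.
have [k [k1 [k2 [[sk sk1 sk2] [dk dk1] k01 kin kout]]]] := transition_exists c1.
have ck : continuous (fun r : R => k (r ^+ 2)).
  by move=> r; exact: (deriv_continuous (deriv_comp (dk _) (deriv_sqr r))).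
have [a [b [eta1 [eta2 [xi1 [xi2 [ba [e11 e21 x11 x21] [x1r x2r] epos D]]]]]]] :=
  layer _ ck (fun r => k01 (r ^+ 2)).
exists (fun q => 2 * ((a - b) * k (normsq q)) + 2 * normsq q * ((a - b) * k1 (normsq q))).
have de1 r r1 : is_derive r (1 : R) eta1 _ := let: And4 d _ _ _ := D r r1 in d.
have de2 r r1 : is_derive r (1 : R) eta2 _ := let: And4 _ d _ _ := D r r1 in d.
have dx1 r r1 : is_derive r (1 : R) xi1 _ := let: And4 _ _ d _ := D r r1 in d.
have dx2 r r1 : is_derive r (1 : R) xi2 _ := let: And4 _ _ _ d := D r r1 in d.
split.
- exact: (vortex_Cc_infty a b h0 sk sk1 kout).
- exact: (vortex_mean0 a b h0 sk sk1 dk kout).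
- exact: (vortex_unstable h0 ba sk1 sk2 dk dk1 kin kout e11 e21 x11 x21 x1r x2r epos
    de1 de2 dx1 dx2).
Qed.
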